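(* Let $S=G/\Gamma$ be an almost abelian solvmanifold of dimension $2n$, with $G=\mathbb{R}\ltimes_\varphi\mathbb{R}^{2n-1}$, and let $(\mathcal{M}_S,D)$ and $(\mathcal{M}_U,d)$ be the minimal model of $S$ and the minimal fibre algebra taken from the Sullivan model of the Mostow fibration of $S$, with $\mathcal{M}_U$ regarded as a graded subspace of $\mathcal{M}_S$. If $D_2|_{\mathcal{M}_U}=d_2$ (that is, $D$ and $d$ coincide on the degree-$2$ part $\mathcal{M}_U^2$) and there exists a co-symplectic structure on $U$, then there exists a symplectic structure on $S$.
   Context: All algebras are over $\mathbb{R}$. A cdga is a graded-commutative differential graded algebra $(\mathcal{A},d)$, $\mathcal{A}=\bigoplus_{p\ge 0}\mathcal{A}^p$, with unit and with $d$ of degree $+1$. A cdga is minimal if it is free graded commutative, $\bigwedge V$ with $V$ graded in positive degrees, where $V$ has an ordered basis $\{x_\alpha\}$ with $dV\subset\bigwedge^{\ge 2}V$ and $dx_\alpha\in\bigwedge(x_\beta)_{\beta<\alpha}$. A minimal model of a cdga is a minimal cdga together with a quasi-isomorphism to it; the minimal model of a space is that of its algebra of (Sullivan or de Rham) forms. Almost abelian solvmanifold of dimension $2n$: $S=G/\Gamma$, where $G=\mathbb{R}\ltimes_{\varphi}\mathbb{R}^{2n-1}$ with Lie algebra $\mathfrak{g}=\mathbb{R}\ltimes_{\mathrm{ad}_{X_{2n}}}\mathbb{R}^{2n-1}$, $\mathbb{R}=\langle X_{2n}\rangle$, $\mathbb{R}^{2n-1}=\langle X_1,\dots,X_{2n-1}\rangle$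 abelian, $\varphi(t)=e^{t\,\mathrm{ad}_{X_{2n}}}$, and $\Gamma=\mathbb{Z}\ltimes_{\varphi|_{\mathbb{Z}}}\mathbb{Z}^{2n-1}$ is a lattice in $G$. Its Mostow fibration is $\mathbb{R}^{2n-1}/\mathbb{Z}^{2n-1}\hookrightarrow S\to\mathbb{R}/\mathbb{Z}$. The submodule $U$: $H^*(\mathbb{R}^{2n-1}/\mathbb{Z}^{2n-1})$ is identified with $H^*(\mathbb{R}^{2n-1})=\bigwedge^*(\mathbb{R}^{2n-1})^*$ (Lie algebra cohomology of the abelian Lie algebra $\mathbb{R}^{2n-1}$). The group $\mathbb{Z}=\pi_1(\mathbb{R}/\mathbb{Z})$ acts on it by monodromy; the generator acts by the automorphism of $\bigwedge^*(\mathbb{R}^{2n-1})^*$ induced by the transpose of $\varphi(1)$, again denoted $\varphi$. $U$ is the largest submodule on which $\mathbb{Z}$ acts nilpotently: $\alpha\in U$ iff $(\varphi-\mathrm{Id})^k(\alpha)=0$ for some integer $k\ge 1$. The models: the Sullivan model of the Mostow fibration has the form $(\bigwedge(A),0)\to(\bigwedge(\langle A\rangle\oplus Y),D)\to(\bigwedge Y,d_Y)$, where $A$ has degree $1$ and $DA=0$. Put $(\mathcal{M}_U,d)=(\bigwedge Y,d_Y)$ and $(\mathcal{M}_S,D)=(\bigwedge(\langle A\rangle\oplus Y),D)$. Then $(\mathcal{M}_U,d)$ is a minimal cdga with a cdga morphism $\rho:\mathcal{M}_U\to\mathcal{A}(\mathbb{R}^{2n-1}/\mathbb{Z}^{2n-1})$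 ($\mathcal{A}(\cdot)$ the algebra of forms) inducing an isomorphism $H^*(\mathcal{M}_U,d)\cong U$; $(\mathcal{M}_S,D)$ is the minimal model of $S$ via a quasi-isomorphism $\tau:\mathcal{M}_S\to\mathcal{A}(S)$; and for each basis generator $x\in Y$, $Dx=dx+yA$ with $y$ (possibly $0$) in the subalgebra generated by the generators of $Y$ preceding $x$. $\mathcal{M}_U=\bigwedge Y$ is regarded as a graded subspace of $\mathcal{M}_S$. A symplectic structure on $S$ is a closed $2$-form $\omega$ on $S$ with $\omega^n\neq 0$ (non-degenerate). A co-symplectic structure on $U$ is a pair $(F,\eta)$ with $F\in\bigwedge^2(\mathbb{R}^{2n-1})^*$ and $\eta\in\bigwedge^1(\mathbb{R}^{2n-1})^*$ such that $[F],[\eta]\in U$ and $F^{n-1}\wedge\eta\neq 0$ (such forms on the abelian Lie algebra $\mathbb{R}^{2n-1}$ are automatically closed). *)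

(* Defs.v *)
From HB Require Import structures.
From Stdlib Require List.
From mathcomp Require Import all_boot all_order all_algebra all_fingroup.
From mathcomp Require Import all_classical all_reals all_analysis.

Set Implicit Arguments.
Unset Strict Implicit.
Unset Printing Implicit Defensive.

Import Order.TTheory GRing.Theory Num.Theory.
Import numFieldNormedType.Exports.

Local Open Scope classical_set_scope.
Local Open Scope ring_scope.

(* [gr p] is the homogeneous component of degree p; the algebra is the        *)
(* internal direct sum of its components.                                     *)
Record gca (R : realType) := Gca {
  gca_alg :> algType R;
  gr : nat -> set gca_alg;
  gr0 : forall p, gr p 0;
  gr_lin : forall p (c : R) a b, gr p a -> gr p b -> gr p (c *: a + b);
  gr_dec : forall a, exists (k : nat) (f : nat -> gca_alg),
    (forall p, gr p (f p)) /\ a = \sum_(p < k) f p;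
  gr_free : forall (k : nat) (f : nat -> gca_alg), (forall p, gr p (f p)) ->
    \sum_(p < k) f p = 0 -> forall p, (p < k)%N -> f p = 0;
  gr1 : gr 0 1;
  grM : forall p q a b, gr p a -> gr q b -> gr (p + q) (a * b);
  gr_comm : forall p q a b, gr p a -> gr q b ->
    a * b = (-1) ^+ (p * q) * (b * a) }.

Record cdga (R : realType) := Cdga {
  cdga_gca :> gca R;
  dd : cdga_gca -> cdga_gca;
  dd_lin : forall (c : R) a b, dd (c *: a + b) = c *: dd a + dd b;
  dd_gr : forall p a, gr p a -> gr p.+1 (dd a);
  dd_dd : forall a, dd (dd a) = 0;
  dd_leibniz : forall p a b, gr p a ->
    dd (a * b) = dd a * b + (-1) ^+ p * (a * dd b) }.

Record gca_morph (R : realType) (A B : gca R) (f : A -> B) : Prop := {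
  gm_lin : forall (c : R) a b, f (c *: a + b) = c *: f a + f b;
  gm_one : f 1 = 1;
  gm_mul : forall a b, f (a * b) = f a * f b;
  gm_gr : forall p a, gr p a -> gr p (f a) }.

Record cdga_morph (R : realType) (A B : cdga R) (f : A -> B) : Prop := {
  cm_gca : gca_morph f;
  cm_dd : forall a, f (dd a) = dd (f a) }.

(* A is the free graded commutative algebra on the graded vector space with   *)
(* basis x, where x i has degree dg i.                                        *)
Definition free_gca (R : realType) (A : gca R) (I : Type) (dg : I -> nat)
    (x : I -> A) : Prop :=
  (forall i, gr (dg i) (x i)) /\
  forall (B : gca R) (b : I -> B), (forall i, gr (dg i) (b i)) ->
    exists! f : A -> B, gca_morph f /\ forall i, f (x i) = b i.

Definition word_span (R : realType) (A : gca R) (I : Type) (x : I -> A)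
    (P : seq I -> Prop) : set A :=
  [set a | exists (k : nat) (c : 'I_k -> R) (s : 'I_k -> seq I),
    (forall l, P (s l)) /\ a = \sum_(l < k) c l *: \prod_(i <- s l) x i].

Definition gen_subalg (R : realType) (A : gca R) (I : Type) (x : I -> A)
    (Q : I -> Prop) : set A := word_span x (List.Forall Q).

Definition word_ge (R : realType) (A : gca R) (I : Type) (x : I -> A)
    (k : nat) : set A := word_span x (fun s => (k <= size s)%N).

Record strict_total_order (I : Type) (lt : I -> I -> Prop) : Prop := {
  sto_irr : forall i, ~ lt i i;
  sto_trans : forall i j k, lt i j -> lt j k -> lt i k;
  sto_total : forall i j, i <> j -> lt i j \/ lt j i }.

Record minimal_cdga (R : realType) (A : cdga R) (I : Type)
    (lt : I -> I -> Prop) (dg : I -> nat) (x : I -> A) : Prop := {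
  mc_order : strict_total_order lt;
  mc_pos : forall i, (0 < dg i)%N;
  mc_free : free_gca dg x;
  mc_decomposable : forall i, word_ge x 2 (dd (x i));
  mc_nilpotent : forall i, gen_subalg x (fun j => lt j i) (dd (x i)) }.

(* A p-covector on R^m is a function of p vectors, given as the rows of a     *)
(* p x m matrix; see [alternating_covec].                                     *)
Definition covec (R : realType) (p m : nat) := 'M[R]_(p, m) -> R.

Definition dform (R : realType) (p m : nat) := 'rV[R]_m -> covec R p m.

Record alternating_covec (R : realType) (p m : nat) (a : covec R p m) :
    Prop := {
  alt_lin : forall (i : 'I_p) (c d : R) (V V1 V2 : 'M[R]_(p, m)),
    row i V = c *: row i V1 + d *: row i V2 ->
    row' i V1 = row' i V -> row' i V2 = row' i V ->
    a V = c * a V1 + d * a V2;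
  alt_eq0 : forall (i j : 'I_p) (V : 'M[R]_(p, m)),
    i != j -> row i V = row j V -> a V = 0 }.

Definition cwedge (R : realType) (p q m : nat) (a : covec R p m)
    (b : covec R q m) : covec R (p + q) m := fun V =>
  (p`! * q`!)%:R^-1 *
  \sum_(s : 'S_(p + q))
    (-1) ^+ s * (a (usubmx (row_perm s V)) * b (dsubmx (row_perm s V))).

Fixpoint cpow (R : realType) (p m : nat) (a : covec R p m) (k : nat) :
    covec R (k * p) m :=
  match k with
  | 0 => fun=> 1
  | k'.+1 => cwedge a (@cpow R p m a k')
  end.
Arguments cpow {R p m} a k _.

Definition fwedge (R : realType) (p q m : nat) (w : dform R p m)
    (u : dform R q m) : dform R (p + q) m := fun x => cwedge (w x) (u x).

Definition fdiff (R : realType) (p m : nat) (w : dform R p m) :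
    dform R p.+1 m := fun x V =>
  \sum_(i < p.+1) (-1) ^+ i * 'D_(row i V) (fun z => w z (row' i V)) x.

Definition pullback (R : realType) (a b : nat) (f : 'rV[R]_a -> 'rV[R]_b)
    (p : nat) (w : dform R p b) : dform R p a := fun x V =>
  w (f x) (\matrix_(i < p) 'D_(row i V) f x).

(* C^oo: every iterated directional derivative is (Frechet) differentiable.   *)
Definition smooth (R : realType) (m : nat) (f : 'rV[R]_m -> R) : Prop :=
  forall (vs : seq 'rV[R]_m) (x : 'rV[R]_m),
    differentiable (foldr (fun v g => fun z => 'D_v g z) f vs) x.

Record smooth_form (R : realType) (p m : nat) (w : dform R p m) : Prop := {
  sf_alt : forall x, alternating_covec (w x);
  sf_smooth : forall V, smooth (fun x => w x V) }.

(* The algebra of forms of a quotient of R^m by a group of diffeomorphisms is *)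
(* the algebra of invariant forms on R^m; it is given by its homogeneous      *)
(* components.                                                                *)
Definition forms (R : realType) (m : nat) := forall p, set (dform R p m).

Definition exact_form (R : realType) (m : nat) (Om : forms R m) (p : nat) :
    dform R p m -> Prop :=
  match p with
  | 0 => fun w => w = (fun _ _ => 0)
  | q.+1 => fun w => exists2 u, Om q u & w = fdiff u
  end.

Definition exact_elt (R : realType) (A : cdga R) (p : nat) (a : A) : Prop :=
  match p with
  | 0 => a = 0
  | q.+1 => exists2 b, gr q b & a = dd b
  end.

(* Morphisms of cdga from A to forms, given degree by degree; the value of    *)
(* f p outside of gr p is irrelevant.                                         *)
Record form_morph (R : realType) (A : cdga R) (m : nat) (Om : forms R m)
    (f : forall p, A -> dform R p m) : Prop := {
  fm_gr : forall p a, gr p a -> Om p (f p a);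
  fm_lin : forall p (c : R) a b, gr p a -> gr p b ->
    f p (c *: a + b) = (fun x V => c * f p a x V + f p b x V);
  fm_one : f 0%N 1 = (fun _ _ => 1);
  fm_mul : forall p q a b, gr p a -> gr q b ->
    f (p + q)%N (a * b) = fwedge (f p a) (f q b);
  fm_dd : forall p a, gr p a -> f p.+1 (dd a) = fdiff (f p a) }.

(* The map induced by f on cohomology is injective, and its image consists of *)
(* the classes of the closed forms in C.                                      *)
Definition cohomology_iso_onto (R : realType) (A : cdga R) (m : nat)
    (Om : forms R m) (f : forall p, A -> dform R p m) (C : forms R m) : Prop :=
  forall p,
  [/\ forall a, gr p a -> dd a = 0 -> exact_form Om (f p a) -> exact_elt p a,
      forall a, gr p a -> dd a = 0 -> exists2 w, C p w &
        exact_form Om (fun x V => f p a x V - w x V) &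
      forall w, C p w -> exists a, [/\ gr p a, dd a = 0 &
        exact_form Om (fun x V => f p a x V - w x V)]].

Definition closed_forms (R : realType) (m : nat) (Om : forms R m) :
    forms R m := fun p => [set w | Om p w /\ fdiff w = (fun _ _ => 0)].

Definition quasi_iso (R : realType) (A : cdga R) (m : nat) (Om : forms R m)
    (f : forall p, A -> dform R p m) : Prop :=
  form_morph Om f /\ cohomology_iso_onto Om f (closed_forms Om).

Definition int_vec (R : realType) (m : nat) : set 'rV[R]_m :=
  [set a | forall j, a 0 j \is a Num.int].

Definition torus_forms (R : realType) (m : nat) : forms R m := fun p =>
  [set w | smooth_form w /\
           forall a, int_vec a -> pullback (fun x => x + a) w = w].

Definition expmx (R : realType) (N : nat) (A : 'M[R]_N) : 'M[R]_N :=
  lim (series (fun k => k`!%:R^-1 *: A ^+ k) @ \oo).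

(* ad is the matrix of the derivation acting on R^N (row vectors): its i-th   *)
(* row is [X, X_i].                                                           *)
Definition phi (R : realType) (N : nat) (ad : 'M[R]_N) (t : R) : 'M[R]_N :=
  expmx (t *: ad).

(* The element of G = R |x_phi R^N with coordinates (t, y) is the product t y *)
(* of t in R and y in R^N.  As t y t^-1 = phi(t) y in G (see [mulG_conj]),    *)
(*   (t y) (s z) = (t + s) (phi(- s) y + z).                                  *)
Definition ptG (R : realType) (N : nat) (t : R) (y : 'rV[R]_N) :
    'rV[R]_(1 + N) := row_mx t%:M y.

Definition tG (R : realType) (N : nat) (g : 'rV[R]_(1 + N)) : R :=
  lsubmx g 0 0.

Definition yG (R : realType) (N : nat) (g : 'rV[R]_(1 + N)) : 'rV[R]_N :=
  rsubmx g.

Definition mulG (R : realType) (N : nat) (ad : 'M[R]_N)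
    (g h : 'rV[R]_(1 + N)) : 'rV[R]_(1 + N) :=
  ptG (tG g + tG h) (yG g *m phi ad (- tG h) + yG h).

Definition invG (R : realType) (N : nat) (ad : 'M[R]_N)
    (g : 'rV[R]_(1 + N)) : 'rV[R]_(1 + N) :=
  ptG (- tG g) (- (yG g *m phi ad (tG g))).

Lemma tG_pt (R : realType) (N : nat) (t : R) (y : 'rV[R]_N) : tG (ptG t y) = t.
Proof. by rewrite /tG /ptG row_mxKl mxE eqxx mulr1n. Qed.

Lemma yG_pt (R : realType) (N : nat) (t : R) (y : 'rV[R]_N) : yG (ptG t y) = y.
Proof. by rewrite /yG /ptG row_mxKr. Qed.

Lemma mulG_conj (R : realType) (N : nat) (ad : 'M[R]_N) (t : R)
    (y : 'rV[R]_N) :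
  mulG ad (mulG ad (ptG t 0) (ptG 0 y)) (ptG (- t) 0) = ptG 0 (y *m phi ad t).
Proof.
by rewrite /mulG !(tG_pt, yG_pt) mul0mx add0r !addr0 subrr opprK.
Qed.

Record lattice (R : realType) (N : nat) (ad : 'M[R]_N)
    (L : set 'rV[R]_(1 + N)) : Prop := {
  lat_one : L 0;
  lat_mul : forall g h, L g -> L h -> L (mulG ad g h);
  lat_inv : forall g, L g -> L (invG ad g);
  lat_discrete : exists2 e : R, 0 < e & forall g, L g -> `|g| < e -> g = 0;
  lat_cocompact : exists2 K : set 'rV[R]_(1 + N), compact K &
    forall g, exists2 h, L h & K (mulG ad g h) }.

(* Forms on G / Gamma, for Gamma = Z |x Z^N the set of integer points of G.   *)
Definition solv_forms (R : realType) (N : nat) (ad : 'M[R]_N) :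
    forms R (1 + N) := fun p =>
  [set w | smooth_form w /\
           forall h, int_vec h -> pullback (fun g => mulG ad g h) w = w].

Definition phi_star (R : realType) (N : nat) (ad : 'M[R]_N) (p : nat)
    (a : covec R p N) : covec R p N := fun V => a (V *m phi ad 1).

Definition Unil (R : realType) (N : nat) (ad : 'M[R]_N) (p : nat) :
    set (covec R p N) :=
  [set a | alternating_covec a /\ exists2 k : nat, (1 <= k)%N &
     iter k (fun b => fun V => phi_star ad b V - b V) a = (fun=> 0)].

(* [Unil] is the submodule U; classes in H^*(R^N / Z^N) are identified       *)
(* with constant forms.                                                       *)
Definition Unil_forms (R : realType) (N : nat) (ad : 'M[R]_N) : forms R N :=
  fun p => [set w | exists2 a, Unil ad a & w = (fun=> a)].

(* In the basis of <A> (+) Y, None stands for A, which precedes Y.            *)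
Definition lt_option (I : Type) (lt : I -> I -> Prop) (a b : option I) : Prop :=
  match a, b with
  | None, Some _ => True
  | Some i, Some j => lt i j
  | _, None => False
  end.

Definition deg_option (I : Type) (dg : I -> nat) (a : option I) : nat :=
  if a is Some i then dg i else 1%N.

(* [MB] = (/\A, 0), [MS] = (/\(<A> (+) Y), D), [MU] = (/\Y, d), with maps     *)
(*      MB --mm_j--> MS --mm_q--> MU                                          *)
(*   sigma|       tau|         rho|                                           *)
(*    A(R / Z) --> A(S) --> A(R^N / Z^N)                                      *)
(* where S = G / Gamma and the fibre is taken over 0.                         *)
Record mostow_model (R : realType) (N : nat) (ad : 'M[R]_N) := {
  mmI : Type;
  mm_lt : mmI -> mmI -> Prop;
  mm_deg : mmI -> nat;

  MB : cdga R;
  MB_gen : MB;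
  MB_free : free_gca (fun _ : unit => 1%N) (fun _ => MB_gen);
  MB_dd : dd MB_gen = 0;

  MS : cdga R;
  MS_gen : option mmI -> MS;
  MS_minimal : minimal_cdga (lt_option mm_lt) (deg_option mm_deg) MS_gen;

  MU : cdga R;
  MU_gen : mmI -> MU;
  MU_minimal : minimal_cdga mm_lt mm_deg MU_gen;

  mm_j : MB -> MS;
  mm_j_morph : cdga_morph mm_j;
  mm_j_gen : mm_j MB_gen = MS_gen None;

  mm_q : MS -> MU;
  mm_q_morph : cdga_morph mm_q;
  mm_q_gen : forall a, mm_q (MS_gen a) = if a is Some i then MU_gen i else 0;

  (* the inclusion of \bigwedge Y as a graded subalgebra, not a subcomplex *)
  mm_inc : MU -> MS;
  mm_inc_morph : gca_morph mm_inc;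
  mm_inc_gen : forall i, mm_inc (MU_gen i) = MS_gen (Some i);

  mm_D : forall i, exists2 y, gen_subalg MU_gen (fun j => mm_lt j i) y &
    dd (MS_gen (Some i)) =
      mm_inc (dd (MU_gen i)) + mm_inc y * MS_gen None;

  mm_sigma : forall p, MB -> dform R p 1;
  mm_sigma_qi : quasi_iso (torus_forms (m := 1)) mm_sigma;

  mm_tau : forall p, MS -> dform R p (1 + N);
  mm_tau_qi : quasi_iso (solv_forms ad) mm_tau;

  mm_rho : forall p, MU -> dform R p N;
  mm_rho_morph : form_morph (torus_forms (m := N)) mm_rho;
  mm_rho_U : cohomology_iso_onto (torus_forms (m := N)) mm_rho (Unil_forms ad);

  mm_base : forall p (b : MB), gr p b ->
    @mm_tau p (mm_j b) = pullback (@lsubmx R 1 1 N) (@mm_sigma p b);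
  mm_fibre : forall p (a : MS), gr p a ->
    pullback (fun y => ptG 0 y) (@mm_tau p a) = @mm_rho p (mm_q a) }.

Arguments mm_j {R N ad} m _.
Arguments mm_q {R N ad} m _.
Arguments mm_inc {R N ad} m _.
Arguments mm_sigma {R N ad} m p _.
Arguments mm_tau {R N ad} m p _.
Arguments mm_rho {R N ad} m p _.

Definition D2_eq_d2 (R : realType) (N : nat) (ad : 'M[R]_N)
    (X : mostow_model ad) : Prop :=
  forall v : MU X, gr 2 v -> dd (mm_inc X v) = mm_inc X (dd v).

Definition cosymplectic (R : realType) (N : nat) (ad : 'M[R]_N) (n : nat)
    (F : covec R 2 N) (eta : covec R 1 N) : Prop :=
  [/\ Unil ad F, Unil ad eta & exists V, cwedge (cpow F n.-1) eta V != 0].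

Definition symplectic (R : realType) (N : nat) (ad : 'M[R]_N) (n : nat)
    (w : dform R 2 (1 + N)) : Prop :=
  [/\ solv_forms ad w, fdiff w = (fun _ _ => 0) &
      forall x, exists V, cpow (w x) n V != 0].

(* Main.v *)
Require Import Defs.
From mathcomp Require Import all_boot all_order all_algebra all_fingroup.
From mathcomp Require Import all_classical all_reals all_analysis.
From mathcomp Require Import ring lra zify.

(** Let N = 2n - 1 be the dimension of the fibre, t the coordinate of the base,
    and (F, eta) the co-symplectic structure on U. The symplectic form is
    omega = F + eta_t /\ dt for a suitable path of constant 1-forms eta_t on the
    fibre. Such a form is closed as soon as F is constant, and it descends to
    S when F is invariant under the monodromy phi = phi(1) and
    eta_(t+1) = phi^* eta_t.

    The hypothesis D_2 = d_2 is what makes F invariant. The class of F is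
    represented by a cocycle a of MU; as D and d agree in degree 2, a is also a
    cocycle of MS, and its image W in the forms on S is a closed form whose
    restriction to the fibre over 0 is F plus an exact form
    ([Unil2_extends]). The restriction of a closed form to the fibre over t has
    a cohomology class that does not depend on t, and the monodromy carries
    the fibre over 0 to the fibre over 1; so F and phi^* F are cohomologous
    constant forms on a torus, hence equal ([closed_extension_invariant]). The
    periods over 2-tori used here need no integral: a Riemann sum with k^2
    terms of an exact coefficient is O(k) ([grid_sum_exact],
    [grid_sum_transport]), which is enough to compare the k^2-multiples of two
    values of F.

    Since eta is in U, phi^* is unipotent on it, and the binomial series gives a
    path eta_t = (phi^* )^t eta polynomial in t with eta_(t+1) = phi^* eta_t
    ([eta_path]). Invariance under every integer translation then rests on the
    law phi(s + t) = phi(s) phi(t) of the matrix exponential ([phiD]).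

    Nondegeneracy is linear algebra. From F^(n-1) /\ eta != 0 one gets that eta
    does not vanish on nonzero vectors of ker F ([cpow_wedge_neq0_kernel]), so
    ker F is at most a line, and it is not 0 because N is odd
    ([odd_kernel]). This line is stable under phi, and unipotence of phi^* on
    eta forces phi to fix it ([kernel_fixed]); hence eta_t = eta on ker F for all
    t, and omega is nondegenerate at each point ([omega_nondegenerate]). A
    nondegenerate form has a symplectic basis, on which its n-th power is
    positive ([symplectic_rows_exist], [cpow_symplectic_rows]). *)

Set Implicit Arguments.
Unset Strict Implicit.
Unset Printing Implicit Defensive.

Import Order.TTheory GRing.Theory Num.Theory.
Import numFieldNormedType.Exports.

Local Open Scope classical_set_scope.
Local Open Scope ring_scope.

(** * Wedge products of multilinear covectors *)

Section Covectors.
Variable R : realType.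

(** Translating the summation index by u shows that a wedge product is
    alternating under row permutations, whatever its factors. *)
Lemma cwedge_perm p q m (a : covec R p m) (b : covec R q m)
    (V : 'M[R]_(p + q, m)) (u : 'S_(p + q)) :
  cwedge a b (row_perm u V) = (-1) ^+ u * cwedge a b V.
Proof.
rewrite /cwedge mulrCA; congr (_ * _).
rewrite [in RHS](reindex_inj (mulIg u)) mulr_sumr /=; apply: eq_bigr => s _.
rewrite row_permM odd_permM signr_addb.
by rewrite [RHS]mulrA [(-1) ^+ u * _]mulrCA -signr_addb addbb mulr1.
Qed.

Lemma row_perm_row m p (V : 'M[R]_(p, m)) (s : 'S_p) i :
  row i (row_perm s V) = row (s i) V.
Proof. by apply/rowP => j; rewrite !mxE. Qed.

(** The rows other than i are compared one at a time, not through row', because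
    a row permutation scatters them over the two factors of a wedge product. *)
Definition multilinear p m (a : covec R p m) :=
  forall (i : 'I_p) (c d : R) (V V1 V2 : 'M[R]_(p, m)),
    row i V = c *: row i V1 + d *: row i V2 ->
    (forall j, j != i -> row j V1 = row j V) ->
    (forall j, j != i -> row j V2 = row j V) ->
    a V = c * a V1 + d * a V2.

Lemma row'_eqP p m (i : 'I_p) (V W : 'M[R]_(p, m)) :
  row' i V = row' i W <-> (forall j, j != i -> row j V = row j W).
Proof.
split=> [/matrixP e j|e].
  rewrite eq_sym => /unlift_some[k -> _].
  by apply/rowP => l; have := e k l; rewrite !mxE.
apply/matrixP => k l; have ki : lift i k != i by rewrite eq_sym neq_lift.
by have /rowP/(_ l) := e _ ki; rewrite !mxE.
Qed.

Lemma alternating_multilinear p m (a : covec R p m) :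
  alternating_covec a -> multilinear a.
Proof.
move=> [lin _] i c d V V1 V2 eV e1 e2.
by apply: (lin i) => //; apply/row'_eqP.
Qed.

(** Exchanging the two equal rows fixes V and changes the sign. *)
Lemma cwedge_eq0 p q m (a : covec R p m) (b : covec R q m) i j
    (V : 'M[R]_(p + q, m)) :
  i != j -> row i V = row j V -> cwedge a b V = 0.
Proof.
move=> ij e; have eV : row_perm (tperm i j) V = V.
  apply/row_matrixP => l; rewrite row_perm_row.
  by case: tpermP => [->|->|].
have := cwedge_perm a b V (tperm i j); rewrite eV odd_tperm ij expr1 mulN1r.
by move/eqP; rewrite -addr_eq0 -mulr2n mulrn_eq0 /= => /eqP.
Qed.

(** In each term of the alternating sum the i-th row occurs in exactly one of
    the two factors, where linearity applies; the other factor is the same for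
    V, V1 and V2. *)
Lemma cwedge_multilinear p q m (a : covec R p m) (b : covec R q m) :
  multilinear a -> multilinear b -> multilinear (cwedge a b).
Proof.
move=> la lb i c d V V1 V2 eV e1 e2.
rewrite /cwedge [c * _]mulrCA [d * _]mulrCA -mulrDr; congr (_ * _).
rewrite !mulr_sumr -big_split; apply: eq_bigr => s _ /=.
have rowE (l : 'I_(p + q)) (W : 'M[R]_(p + q, m)) :
    row l W = row (s (s^-1%g l)) W by rewrite permKV.
have top (l : 'I_p) (W : 'M[R]_(p + q, m)) :
    row l (usubmx (row_perm s W)) = row (s (lshift q l)) W.
  by apply/rowP => z; rewrite !mxE.
have bot (l : 'I_q) (W : 'M[R]_(p + q, m)) :
    row l (dsubmx (row_perm s W)) = row (s (rshift p l)) W.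
  by apply/rowP => z; rewrite !mxE.
have same (W : 'M[R]_(p + q, m)) l : (forall j, j != i -> row j W = row j V) ->
    l != s^-1%g i -> row (s l) W = row (s l) V.
  by move=> e li; apply: e; apply: contraNneq li => <-; rewrite permK.
rewrite -(permKV s i) in eV.
have distl (e x y z : R) :
  e * ((c * x + d * y) * z) = c * (e * (x * z)) + d * (e * (y * z)) by ring.
have distr (e x y z : R) :
  e * (z * (c * x + d * y)) = c * (e * (z * x)) + d * (e * (z * y)) by ring.
case: (split_ordP (s^-1%g i)) same eV => k -> same eV.
  have -> : a (usubmx (row_perm s V)) = c * a (usubmx (row_perm s V1)) +
      d * a (usubmx (row_perm s V2)).
    by apply: (la k) => [|j jk|j jk]; rewrite !top // same // (inj_eq (@lshift_inj _ _)).
  have eb W : (forall j, j != i -> row j W = row j V) ->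
      dsubmx (row_perm s W) = dsubmx (row_perm s V).
    move=> e; apply/row_matrixP => l; rewrite !bot same //.
    by rewrite eq_rlshift.
  by rewrite (eb V1 e1) (eb V2 e2) distl.
have -> : b (dsubmx (row_perm s V)) = c * b (dsubmx (row_perm s V1)) +
    d * b (dsubmx (row_perm s V2)).
  by apply: (lb k) => [|j jk|j jk]; rewrite !bot // same // (inj_eq (@rshift_inj _ _)).
have ea W : (forall j, j != i -> row j W = row j V) ->
    usubmx (row_perm s W) = usubmx (row_perm s V).
  move=> e; apply/row_matrixP => l; rewrite !top same //.
  by rewrite eq_lrshift.
by rewrite (ea V1 e1) (ea V2 e2) distr.
Qed.

Lemma cpow_multilinear p m (a : covec R p m) k :
  multilinear a -> multilinear (cpow a k).
Proof.
by move=> la; elim: k => [[]|k IH] //=; apply: cwedge_multilinear.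
Qed.

Definition kills_row p m (k : 'rV[R]_m) (a : covec R p m) :=
  forall V i, row i V = k -> a V = 0.

Lemma cwedge_kills_row p q m (k : 'rV[R]_m) (a : covec R p m)
    (b : covec R q m) :
  kills_row k a -> kills_row k b -> kills_row k (cwedge a b).
Proof.
move=> ka kb V i eV; rewrite /cwedge big1 ?mulr0 // => s _.
case: (split_ordP (s^-1%g i)) => l e.
  rewrite (ka _ l) ?mul0r ?mulr0 // -eV -(permKV s i) e.
  by apply/rowP => z; rewrite !mxE.
rewrite (kb _ l) ?mul0r ?mulr0 // -eV -(permKV s i) e.
by apply/rowP => z; rewrite !mxE.
Qed.

Lemma cpow_kills_row p m (k : 'rV[R]_m) (a : covec R p m) j :
  kills_row k a -> kills_row k (cpow a j).
Proof.
by move=> ka; elim: j => [V []|j IH] //=; apply: cwedge_kills_row.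
Qed.

(** If u 0 i is nonzero, replacing the i-th row of V by u *m V multiplies the
    value by u 0 i: the other rows contribute repeated rows. *)
Lemma alternating_combination p m (a : covec R p m) (V : 'M[R]_(p, m))
    (u : 'rV[R]_p) :
  multilinear a ->
  (forall i j (W : 'M[R]_(p, m)), i != j -> row i W = row j W -> a W = 0) ->
  u != 0 -> kills_row (u *m V) a -> a V = 0.
Proof.
move=> la aa u0 ka.
have [i ui0] : exists i, u 0 i != 0.
  apply/existsP; apply: contraNT u0; rewrite negb_exists => /forallP h.
  by apply/eqP/rowP => i; rewrite mxE; apply/eqP; have := h i; rewrite negbK.
pose W x := \matrix_(l < p) (if l == i then x else row l V).
have Wi x : row i (W x) = x by rewrite rowK eqxx.
have Wj x j : j != i -> row j (W x) = row j V by rewrite rowK => /negPf ->.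
have lin c d x y : a (W (c *: x + d *: y)) = c * a (W x) + d * a (W y).
  by apply: (la i) => [|j ji|j ji]; rewrite ?Wi // !Wj.
have W0 : a (W 0) = 0.
  by have := lin 0 0 0 0; rewrite !scale0r addr0 !mul0r addr0.
have WD x y : a (W (x + y)) = a (W x) + a (W y).
  by have := lin 1 1 x y; rewrite !scale1r !mul1r.
have WZ c x : a (W (c *: x)) = c * a (W x).
  by have := lin c 0 x 0; rewrite scaler0 addr0 mul0r addr0.
have : a (W (u *m V)) = u 0 i * a V.
  rewrite mulmx_sum_row (big_morph (fun x => a (W x)) WD W0) (bigD1 i) //=.
  rewrite big1 ?addr0 => [|j ji].
    rewrite WZ; congr (_ * a _); apply/row_matrixP => l.
    by have [->|li] := eqVneq l i; [rewrite Wi|rewrite Wj].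
  rewrite WZ (aa i j) ?mulr0 //; first by rewrite eq_sym.
  by rewrite Wi Wj.
rewrite (ka _ i) ?Wi // => /esym/eqP; rewrite mulf_eq0 (negPf ui0) /=.
by move/eqP.
Qed.

End Covectors.

(** * Alternating 2-covectors *)

Section TwoForms.
Variable R : realType.

Definition ev2 m (a : covec R 2 m) (x y : 'rV[R]_m) : R :=
  a (col_mx x y : 'M[R]_(1 + 1, m)).

Lemma ord2_cases (i : 'I_2) : i = ord0 \/ i = ord_max.
Proof. by case: i => -[|[|]] // i; [left|right]; apply/val_inj. Qed.

Lemma row0_col_mx m (x y : 'rV[R]_m) :
  row ord0 (col_mx x y : 'M[R]_(1 + 1, m)) = x.
Proof.
apply/rowP => j; rewrite mxE -[RHS](col_mxEu x y).
by congr (col_mx x y _ j); apply/val_inj.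
Qed.

Lemma row1_col_mx m (x y : 'rV[R]_m) :
  row ord_max (col_mx x y : 'M[R]_(1 + 1, m)) = y.
Proof.
apply/rowP => j; rewrite mxE -[RHS](col_mxEd x y).
by congr (col_mx x y _ j); apply/val_inj.
Qed.

Lemma col_mx_rows m (V : 'M[R]_(2, m)) :
  V = col_mx (row ord0 V) (row ord_max V) :> 'M[R]_(1 + 1, m).
Proof.
apply/row_matrixP => -[[|[]]] // i.
  by rewrite (_ : Ordinal i = ord0) ?row0_col_mx //; apply/val_inj.
by rewrite (_ : Ordinal i = ord_max) ?row1_col_mx //; apply/val_inj.
Qed.

Lemma ev2E m (a : covec R 2 m) V : a V = ev2 a (row ord0 V) (row ord_max V).
Proof. by rewrite [in LHS](col_mx_rows V). Qed.

Section Alternating.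
Variables (m : nat) (a : covec R 2 m).
Hypothesis alt_a : alternating_covec a.

Lemma ev2xx x : ev2 a x x = 0.
Proof.
by apply: (alt_eq0 alt_a (i := ord0) (j := ord_max));
  rewrite ?row0_col_mx ?row1_col_mx.
Qed.

Lemma ev2_linl c d x y z :
  ev2 a (c *: x + d *: y) z = c * ev2 a x z + d * ev2 a y z.
Proof.
apply: (alternating_multilinear alt_a (i := ord0)); rewrite ?row0_col_mx //.
  by case=> -[|[]] // i _; rewrite (_ : Ordinal i = ord_max) ?row1_col_mx //;
    apply/val_inj.
by case=> -[|[]] // i _; rewrite (_ : Ordinal i = ord_max) ?row1_col_mx //;
  apply/val_inj.
Qed.

Lemma ev2Dl x y z : ev2 a (x + y) z = ev2 a x z + ev2 a y z.
Proof. by have := ev2_linl 1 1 x y z; rewrite !scale1r !mul1r. Qed.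

Lemma ev20l z : ev2 a 0 z = 0.
Proof. by have := ev2_linl 0 0 0 0 z; rewrite scale0r addr0 !mul0r addr0. Qed.

Lemma ev2Zl c x z : ev2 a (c *: x) z = c * ev2 a x z.
Proof. by have := ev2_linl c 0 x 0 z; rewrite scaler0 addr0 mul0r addr0. Qed.

Lemma ev2C x y : ev2 a x y = - ev2 a y x.
Proof.
apply/eqP; rewrite -addr_eq0; apply/eqP.
have rD u v w : ev2 a u (v + w) = ev2 a u v + ev2 a u w.
  have := alternating_multilinear alt_a (i := ord_max) (c := 1) (d := 1)
    (V := col_mx u (v + w) : 'M[R]_(1 + 1, m)) (V1 := col_mx u v : 'M[R]_(1 + 1, m))
    (V2 := col_mx u w : 'M[R]_(1 + 1, m)).
  rewrite !row1_col_mx !scale1r !mul1r; apply=> // -[[|[]]] // i _;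
  by rewrite (_ : Ordinal i = ord0) ?row0_col_mx //; apply/val_inj.
by have := ev2xx (x + y); rewrite ev2Dl !rD !ev2xx add0r addr0.
Qed.

Lemma ev2Dr x y z : ev2 a x (y + z) = ev2 a x y + ev2 a x z.
Proof. by rewrite ev2C ev2Dl opprD -!ev2C. Qed.

Lemma ev20r x : ev2 a x 0 = 0.
Proof. by rewrite ev2C ev20l oppr0. Qed.

Lemma ev2Zr c x y : ev2 a x (c *: y) = c * ev2 a x y.
Proof. by rewrite ev2C ev2Zl -mulrN -ev2C. Qed.

Lemma ev2Nr x y : ev2 a x (- y) = - ev2 a x y.
Proof. by rewrite -scaleN1r ev2Zr mulN1r. Qed.

Definition gram : 'M[R]_m :=
  \matrix_(i, j) ev2 a (delta_mx 0 i) (delta_mx 0 j).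

Lemma ev2_gram x y : ev2 a x y = (x *m gram *m y^T) 0 0.
Proof.
have e1 u : ev2 a x u = (x *m (\col_i ev2 a (delta_mx 0 i) u)) 0 0.
  rewrite {1}(row_sum_delta x).
  rewrite (big_morph (ev2 a ^~ u) (fun v w => ev2Dl v w u) (ev20l u)).
  by rewrite mxE; apply: eq_bigr => i _; rewrite ev2Zl mxE.
rewrite e1 {1}(row_sum_delta y) mxE [RHS]mxE.
under [RHS]eq_bigr do rewrite mxE mulr_suml.
rewrite exchange_big /=; apply: eq_bigr => i _.
rewrite mxE (big_morph _ (ev2Dr (delta_mx 0 i)) (ev20r _)) mulr_sumr.
by apply: eq_bigr => j _; rewrite ev2Zr !mxE; ring.
Qed.

Lemma gramT : gram^T = - gram.
Proof. by apply/matrixP => i j; rewrite !mxE ev2C. Qed.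

End Alternating.

(** The Gram matrix equals minus its transpose, so in odd dimension its
    determinant vanishes. *)
Lemma odd_kernel m (a : covec R 2 m) : alternating_covec a -> odd m ->
  exists2 k : 'rV[R]_m, k != 0 & forall y, ev2 a k y = 0.
Proof.
move=> alt_a om; have /eqP/det0P[k k0 ka] : \det (gram a) = 0.
  have := det_tr (gram a); rewrite gramT // -scaleN1r detZ -signr_odd om mulN1r.
  by move/eqP; rewrite eq_sym -addr_eq0 -mulr2n mulrn_eq0 /= => /eqP.
by exists k => // y; rewrite ev2_gram // ka mul0mx mxE.
Qed.

(** A common null vector k of F and eta would make F^m /\ eta vanish on every
    family with k among its rows, hence on every family V of N vectors: either
    V is a basis, and k is a combination of its rows, or some nontrivial
    combination of its rows is 0. *)
Lemma cpow_wedge_neq0_kernel m N (F : covec R 2 N) (eta : covec R 1 N) V k :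
  N = (m * 2 + 1)%N -> alternating_covec F -> alternating_covec eta ->
  cwedge (cpow F m) eta V != 0 ->
  k != 0 -> (forall y, ev2 F k y = 0) -> eta k != 0.
Proof.
move=> eN aF aeta nz k0 Fk; apply: contraNneq nz => etak.
have kF : kills_row k F.
  move=> W [[|[]]] // i.
    by rewrite (_ : Ordinal i = ord0) ?ev2E => [->//|]; apply/val_inj.
  rewrite (_ : Ordinal i = ord_max) ?ev2E => [->|]; last exact/val_inj.
  by rewrite ev2C // Fk oppr0.
have keta : kills_row k eta.
  by move=> W i; rewrite ord1 row_id => ->.
have c0 : kills_row k (cwedge (cpow F m) eta).
  by apply: cwedge_kills_row => //; exact: cpow_kills_row.
have ml : multilinear (cwedge (cpow F m) eta).
  apply: cwedge_multilinear; last exact: alternating_multilinear.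
  exact/cpow_multilinear/alternating_multilinear.
have aa i j W : i != j -> row i W = row j W -> cwedge (cpow F m) eta W = 0.
  exact: cwedge_eq0.
apply/eqP; have [fV|] := boolP (row_free V).
  have /submxP[u ku] : (k <= V)%MS by rewrite submx_full // /row_full (eqP fV) eN.
  apply: (alternating_combination (u := u)) => //; last by rewrite -ku.
  by apply: contraNneq k0 => u0; rewrite ku u0 mul0mx.
rewrite -kermx_eq0 => /rowV0Pn[u /sub_kermxP uV u0].
apply: (alternating_combination (u := u)) => //.
rewrite uV => W i Wi; have := ml i 0 0 W W W.
by rewrite !scale0r addr0 !mul0r addr0; apply.
Qed.

End TwoForms.

(** * Powers of a 2-covector on a symplectic basis *)

Section SymplecticBasis.
Variable R : realType.

(** A symplectic basis is listed as x_0, y_0, x_1, y_1, ..., so that the rows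
    2i and 2i + 1 are paired. *)
Definition partner (i : nat) := if odd i then i.-1 else i.+1.

Lemma partnerK : involutive partner.
Proof.
move=> i; rewrite /partner; case oi: (odd i); last by rewrite /= oi.
by case: i oi => //= j /negbTE ->.
Qed.

Lemma partner_lt k i : (i < k * 2)%N -> (partner i < k * 2)%N.
Proof.
rewrite /partner muln2; case: ifP => [_ |/negbT oi] h.
  exact: leq_ltn_trans (leq_pred _) h.
rewrite ltn_neqAle h andbT; apply: contraNneq oi => e.
by have := odd_double k; rewrite -e /= => /negbFE.
Qed.

(** The Gram matrix of a symplectic basis. *)
Definition sympl_entry (i j : nat) : R := (-1) ^+ odd i * (j == partner i)%:R.

Definition symplectic_rows m (a : covec R 2 m) p (V : 'M[R]_(p, m)) :=
  forall i j : 'I_p, ev2 a (row i V) (row j V) = sympl_entry i j.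

Lemma cpow_perm m (a : covec R 2 m) k (V : 'M[R]_(k * 2, m)) (u : 'S_(k * 2)) :
  cpow a k (row_perm u V) = (-1) ^+ u * cpow a k V.
Proof.
case: k V u => [|k] V u; last exact: cwedge_perm.
by rewrite (_ : u = 1%g) ?odd_perm1 ?mul1r //; apply/permP => -[].
Qed.

Lemma fix0_lift_perm n (u : 'S_n.+1) : u ord0 = ord0 ->
  exists u' : 'S_n, u = lift_perm ord0 ord0 u'.
Proof.
move=> u0.
have /boolp.choice[f fE] (i : 'I_n) : exists j : 'I_n,
    u (lift ord0 i) = lift ord0 j.
  have : ord0 != u (lift ord0 i).
    by rewrite -[X in X != _]u0 (inj_eq perm_inj) neq_lift.
  by case/unlift_some => j -> _; exists j.
have fi : injective f.
  move=> i j e; apply: (@lift_inj _ ord0); apply: (@perm_inj _ u).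
  by rewrite !fE e.
exists (perm fi); apply/permP => i.
case: (unliftP ord0 i) => [j|] ->; last by rewrite u0 lift_perm_id.
by rewrite lift_perm_lift permE fE.
Qed.

Lemma odd_lift_perm00 n (u : 'S_n) : lift_perm ord0 ord0 u = u :> bool.
Proof. by rewrite odd_lift_perm addbb. Qed.

(** Summands of a /\ a^k with the same first pair differ by such a permutation,
    which acts on the factor a^k with its own sign. *)
Lemma fix01_lift_perm k (u : 'S_(2 + k)) :
  u (lshift k ord0) = lshift k ord0 -> u (lshift k ord_max) = lshift k ord_max ->
  exists2 u' : 'S_k, u = u' :> bool &
    forall i, u (rshift 2 i) = rshift 2 (u' i).
Proof.
rewrite (_ : lshift k ord0 = ord0); last exact/val_inj.
move=> /fix0_lift_perm[v ->].
have -> : lshift k (ord_max : 'I_2) = lift ord0 (ord0 : 'I_k.+1) by exact/val_inj.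
rewrite lift_perm_lift => /lift_inj/fix0_lift_perm[u' ->]; exists u' => [|i].
  by rewrite !odd_lift_perm00.
have rE j : rshift 2 j = lift ord0 (lift ord0 j : 'I_k.+1) by exact/val_inj.
by rewrite !rE !lift_perm_lift.
Qed.

(** The summand of the identity permutation in the alternating sum for
    a /\ a^k, up to normalisation. *)
Definition top_term m (a : covec R 2 m) k (V : 'M[R]_(2 + k * 2, m)) :=
  a (usubmx V) * cpow a k (dsubmx V).

Lemma top_term_fix01 m (a : covec R 2 m) k (V : 'M[R]_(2 + k * 2, m))
    (u : 'S_(2 + k * 2)) :
  u (lshift _ ord0) = lshift _ ord0 -> u (lshift _ ord_max) = lshift _ ord_max ->
  (-1) ^+ u * top_term a (row_perm u V) = top_term a V.
Proof.
move=> u0 u1; have [u' eu ur] := fix01_lift_perm u0 u1.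
rewrite /top_term eu (_ : usubmx _ = usubmx V); last first.
  apply/matrixP => -[[|[|]]] // i j; rewrite !mxE;
  [rewrite (_ : Ordinal i = ord0) ?u0 //| rewrite (_ : Ordinal i = ord_max) ?u1 //];
  exact/val_inj.
rewrite (_ : dsubmx _ = row_perm u' (dsubmx V)); last first.
  by apply/matrixP => i j; rewrite !mxE ur.
by rewrite cpow_perm mulrCA [X in _ * X = _]mulrA -signr_addb addbb mul1r.
Qed.

(** An even permutation that brings the pair {a, a + 1} to the front and respects
    the pairing, so that it maps symplectic bases to symplectic bases. *)
Definition swap_pair (a i : nat) :=
  if i == 0%N then a else if i == 1%N then a.+1 else
  if i == a then 0%N else if i == a.+1 then 1%N else i.

Lemma swap_pairK a : ~~ odd a -> involutive (swap_pair a).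
Proof. by rewrite /swap_pair => ea i; do !case: eqP => //; lia. Qed.

Lemma odd_swap_pair a i : ~~ odd a -> odd (swap_pair a i) = odd i.
Proof. by rewrite /swap_pair => ea; do !case: eqP => //; lia. Qed.

Lemma partner_swap_pair a i : ~~ odd a ->
  partner (swap_pair a i) = swap_pair a (partner i).
Proof.
move=> ea; rewrite /partner odd_swap_pair //; rewrite /swap_pair.
by case: ifP => oi; do !case: eqP => //; lia.
Qed.

Lemma sympl_entry_swap_pair a i j : ~~ odd a ->
  sympl_entry (swap_pair a i) (swap_pair a j) = sympl_entry i j.
Proof.
move=> ea; rewrite /sympl_entry odd_swap_pair // partner_swap_pair //.
by rewrite (inj_eq (inv_inj (swap_pairK ea))).
Qed.

Section Positivity.
Variables (m : nat) (a : covec R 2 m) (k : nat).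
Hypothesis alt_a : alternating_covec a.
Local Notation i0 := (lshift (k * 2) (ord0 : 'I_2)).
Local Notation i1 := (lshift (k * 2) (ord_max : 'I_2)).

Lemma top_ev2 (V : 'M[R]_(2 + k * 2, m)) :
  a (usubmx V) = ev2 a (row i0 V) (row i1 V).
Proof. by rewrite ev2E; congr ev2; apply/rowP => j; rewrite !mxE. Qed.

Lemma top_term_gt0 (V : 'M[R]_(2 + k * 2, m)) :
  (forall W : 'M[R]_(k * 2, m), symplectic_rows a W -> 0 < cpow a k W) ->
  symplectic_rows a V -> 0 < top_term a V.
Proof.
move=> IH sV; rewrite /top_term top_ev2 sV.
rewrite (_ : sympl_entry _ _ = 1) ?mul1r; last by rewrite /sympl_entry /= mulr1.
apply: IH => i j.
have rE l : row l (dsubmx V) = row (rshift 2 l) V.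
  by apply/rowP => z; rewrite !mxE.
by rewrite !rE sV /sympl_entry /partner /= negbK; case: ifP; case: (nat_of_ord i).
Qed.

Lemma top_term_tperm (V : 'M[R]_(2 + k * 2, m)) :
  top_term a (row_perm (tperm i0 i1) V) = - top_term a V.
Proof.
rewrite /top_term !top_ev2 !row_perm_row tpermL tpermR ev2C // mulNr.
congr (- (_ * cpow a k _)); apply/matrixP => i j; rewrite !mxE.
by rewrite tpermD.
Qed.

(** A summand vanishes unless the permutation s sends the first two positions to
    paired rows. Up to exchanging these two positions the pair is a, a + 1 with
    a even; then s differs from the corresponding pair exchange g by a
    permutation fixing the first two positions, and the summand is the one of
    the identity for another symplectic basis. *)
Lemma signed_top_term_ge0 (V : 'M[R]_(2 + k * 2, m)) (s : 'S_(2 + k * 2)) :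
  (forall W : 'M[R]_(k * 2, m), symplectic_rows a W -> 0 < cpow a k W) ->
  symplectic_rows a V -> 0 <= (-1) ^+ s * top_term a (row_perm s V).
Proof.
move=> IH sV.
have [e1|ne] := eqVneq (s i1 : nat) (partner (s i0)); last first.
  rewrite /top_term top_ev2 !row_perm_row sV /sympl_entry (negPf ne).
  by rewrite mulr0 mul0r mulr0.
wlog : s e1 / ~~ odd (s i0).
  have [oi H|ei] := boolP (odd (s i0)); last exact.
  have := H (tperm i0 i1 * s)%g; rewrite !permM tpermL tpermR e1 partnerK.
  rewrite row_permM top_term_tperm odd_permM odd_tperm /= signrN mulrNN.
  apply=> //; rewrite /partner oi; by case: (nat_of_ord (s i0)) oi.
move=> ei; rewrite /partner (negPf ei) in e1.
pose g := (tperm i0 (s i0) * tperm i1 (s i1))%g.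
have gE i : g i = swap_pair (s i0) i :> nat.
  rewrite /g permM !permE /= -!val_eqE /swap_pair /=.
  by do !case: eqP => //=; lia.
have odd_g : odd_perm g = false.
  rewrite odd_permM !odd_tperm -!val_eqE /= e1.
  by case: (nat_of_ord (s i0)) ei => [|[]].
have g0 : g i0 = s i0 by apply/val_inj; rewrite /= gE.
have g1 : g i1 = s i1 by apply/val_inj; rewrite /= gE.
pose u := (s * g^-1)%g.
have -> : s = (u * g)%g by rewrite /u mulgKV.
rewrite row_permM odd_permM odd_g addbF top_term_fix01.
- apply/ltW/top_term_gt0 => // i j.
  by rewrite !row_perm_row sV !gE sympl_entry_swap_pair.
- by rewrite permM -g0 permK.
- by rewrite permM -g1 permK.
Qed.

End Positivity.

(** No cancellation occurs: every summand is nonnegative, and the one of the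
    identity is positive. *)
Lemma cpow_symplectic_rows m (a : covec R 2 m) k (V : 'M[R]_(k * 2, m)) :
  alternating_covec a -> symplectic_rows a V -> 0 < cpow a k V.
Proof.
move=> alt_a; elim: k V => [|k IH] V sV; first exact: ltr01.
rewrite [cpow _ _ _]/(cwedge a (cpow a k) V) /cwedge mulr_gt0 //.
rewrite (bigD1 1%g) //= ltr_pwDl //.
  by rewrite odd_perm1 mul1r row_perm1; apply: top_term_gt0.
by apply: sumr_ge0 => s _; apply: signed_top_term_ge0.
Qed.

(** Hyperbolic pairs are added one at a time: x is taken orthogonal to the pairs
    already built, y is any vector paired to 1 with x, made orthogonal to these
    pairs. *)
Lemma symplectic_rows_exist m (a : covec R 2 m) k :
  alternating_covec a ->
  (forall x, (forall y, ev2 a x y = 0) -> x = 0) ->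
  (k * 2 <= m)%N -> exists V : 'M[R]_(k * 2, m), symplectic_rows a V.
Proof.
move=> alt_a nd; elim: k => [|k IH] km; first by exists 0 => -[].
have [|V sV] := IH; first by apply: leq_trans km; rewrite leq_mul2r leqnSn orbT.
have [x x0 xV] : exists2 x : 'rV_m, x != 0 & forall i, ev2 a x (row i V) = 0.
  have : kermx (gram a *m V^T) != 0.
    rewrite -mxrank_eq0 mxrank_ker subn_eq0 -ltnNge.
    by apply: leq_ltn_trans (rank_leq_col _) _; lia.
  case/rowV0Pn => x /sub_kermxP xV x0; exists x => // i.
  have /rowP/(_ i) := xV; rewrite [RHS]mxE => <-.
  rewrite ev2_gram // mulmxA !mxE; apply: eq_bigr => j _.
  by rewrite !mxE.
have [z xz] : exists z, ev2 a x z != 0.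
  apply/not_existsP => h; case/eqP: x0; apply: nd => y.
  by apply/eqP; apply: contrapT => /negP/h.
pose y0 := (ev2 a x z)^-1 *: z.
have xy0 : ev2 a x y0 = 1 by rewrite ev2Zr // mulVf.
pose c (i : 'I_(k * 2)) :=
  (-1) ^+ odd i * ev2 a y0 (row (Ordinal (partner_lt (ltn_ord i))) V).
pose w := \sum_i c i *: row i V.
have ev2w v : ev2 a v w = \sum_i c i * ev2 a v (row i V).
  rewrite (big_morph _ (ev2Dr alt_a v) (ev20r alt_a v)).
  by apply: eq_bigr => i _; rewrite ev2Zr.
pose y := y0 - w.
have xy : ev2 a x y = 1.
  rewrite ev2Dr // ev2Nr // ev2w big1 ?oppr0 ?addr0 // => i _.
  by rewrite xV mulr0.
have Vy i : ev2 a (row i V) y = 0.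
  rewrite ev2Dr // ev2Nr // ev2w.
  pose j := Ordinal (partner_lt (ltn_ord i)).
  rewrite (bigD1 j) //= big1 ?addr0 => [|l lj]; last first.
    rewrite sV /sympl_entry (_ : (_ == _) = false) ?mulr0 //.
    by apply: contra_neqF lj => /eqP e; apply/val_inj.
  rewrite sV /sympl_entry eqxx mulr1 /c.
  rewrite (_ : Ordinal _ = i); last by apply/val_inj; rewrite /= partnerK.
  rewrite (ev2C alt_a y0) mulrN mulNr opprK /=.
  have -> : odd (partner i) = ~~ odd i.
    rewrite /partner; case oi: (odd i); last by rewrite /= oi.
    by case: (nat_of_ord i) oi => //= l /negbTE ->.
  by case: (odd i) => /=; ring.
pose W : 'M[R]_((1 + 1) + k * 2, m) := col_mx (col_mx x y) V.
suff sW : symplectic_rows a W by exists W.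
have yV i : ev2 a y (row i V) = 0 by rewrite ev2C // Vy oppr0.
have Vx i : ev2 a (row i V) x = 0 by rewrite ev2C // xV oppr0.
have shift2 i j : sympl_entry i.+2 j.+2 = sympl_entry i j.
  by rewrite /sympl_entry /partner /= negbK; case: ifP; case: i.
have off i j : (i < 2)%N -> sympl_entry i (2 + j) = 0 /\ sympl_entry (2 + j) i = 0.
  move=> i2; rewrite /sympl_entry.
  have -> : (2 + j == partner i)%N = false.
    by rewrite /partner; case: ifP => oi; apply/eqP; lia.
  have -> : (i == partner (2 + j))%N = false.
    by rewrite /partner; case: ifP => oi; apply/eqP; lia.
  by rewrite !mulr0.
move=> i j; rewrite /W.
case: (split_ordP i) => i' ->; case: (split_ordP j) => j' ->;
  rewrite ?(rowKu, rowKd) /=.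
- case: (ord2_cases i') => ->; case: (ord2_cases j') => ->;
    rewrite ?row0_col_mx ?row1_col_mx ?ev2xx ?xy // /sympl_entry /= ?mulr0 ?mulr1 //.
  by rewrite ev2C // xy.
- rewrite (off _ _ (ltn_ord _)).1.
  by case: (ord2_cases i') => ->; rewrite ?row0_col_mx ?row1_col_mx.
- rewrite (off _ _ (ltn_ord _)).2.
  by case: (ord2_cases j') => ->; rewrite ?row0_col_mx ?row1_col_mx.
- by rewrite sV shift2.
Qed.

End SymplecticBasis.

(** * The one-parameter group of a matrix *)

Section MatrixExponential.
Variables (R : realType) (N : nat) (A : 'M[R]_N).

Lemma cvg_mx_entries (f : nat -> 'M[R]_N) (L : 'M[R]_N) :
  (forall i j, (fun k => f k i j) @ \oo --> L i j) -> f @ \oo --> L.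
Proof.
move=> h; apply/cvg_ballP => e e0.
have : \forall n \near \oo, forall i j, ball (L i j) e (f n i j).
  apply: filter_forall => i; apply: filter_forall => j.
  by have /cvg_ballP/(_ _ e0) := h i j.
by apply: filterS => n; split.
Qed.

Lemma expr_scalemx t k : (t *: A) ^+ k = t ^+ k *: A ^+ k.
Proof.
elim: k => [|k IH]; first by rewrite !expr0 scale1r.
by rewrite !exprS IH /GRing.mul /= -scalemxAl -scalemxAr scalerA.
Qed.

(** The coefficients of the power series, in t, of an entry of the p-th
    derivative of exp (t A). *)
Definition exp_entry p i j (k : nat) : R := k`!%:R^-1 * (A ^+ (k + p)) i j.

Lemma pow_entry_bound : exists2 C : R, 0 <= C &
  forall k i j, `|(A ^+ k) i j| <= C ^+ k.
Proof.
pose C := \sum_i \sum_j `|A i j|.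
have C0 : 0 <= C by do 2!apply: sumr_ge0 => ? _.
exists C => // k; elim: k => [|k IH] i j.
  by rewrite !expr0 mxE; case: (i == j); rewrite ?normr1 ?normr0.
rewrite exprSr mxE; apply: le_trans (ler_norm_sum _ _ _) _.
rewrite exprSr mulr_sumr; apply: ler_sum => l _.
rewrite normrM ler_pM // (bigD1 j) //= lerDl.
exact: sumr_ge0.
Qed.

Lemma is_cvg_exp_entry p i j t : cvgn (pseries (exp_entry p i j) t).
Proof.
have [C C0 hC] := pow_entry_bound.
apply: normed_cvg.
apply: (@series_le_cvg _ _ (fun k => C ^+ p * exp_coeff (C * `|t|) k)).
- by move=> k; exact: normr_ge0.
- by move=> k; rewrite mulr_ge0 ?exprn_ge0 // exp_coeff_ge0 // mulr_ge0.
- move=> k; rewrite /exp_entry /exp_coeff /= !normrM normfV normr_nat normrX.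
  rewrite exprMn [leRHS]mulrA [leRHS]mulrC -mulrA ler_wpM2l ?invr_ge0 //.
  by rewrite mulrA -exprD addnC ler_wpM2r ?exprn_ge0.
- exact/is_cvg_seriesZ/is_cvg_series_exp_coeff.
Qed.

Lemma phi_entry t i j : phi A t i j = limn (pseries (exp_entry 0 i j) t).
Proof.
pose L := \matrix_(i, j) limn (pseries (exp_entry 0 i j) t).
suff -> : phi A t = L by rewrite mxE.
apply/cvg_lim => //; apply: cvg_mx_entries => k l; rewrite mxE.
have -> : (fun n => series (fun k => k`!%:R^-1 *: (t *: A) ^+ k) n k l) =
    pseries (exp_entry 0 k l) t.
  apply/funext => n; rewrite /pseries /series /= summxE; apply: eq_bigr => m _.
  by rewrite expr_scalemx !mxE /exp_entry addn0; ring.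
exact: is_cvg_exp_entry.
Qed.

Lemma phi0 : phi A 0 = 1%:M.
Proof.
apply/matrixP => i j; rewrite phi_entry; apply: lim_near_cst => //.
near=> n; rewrite /pseries /series /= -[n]prednK; last by near: n; exists 1%N.
rewrite big_mkord big_ord_recl /= expr0 mulr1 big1 ?addr0 => [|k _].
  by rewrite /exp_entry fact0 invr1 mul1r addn0 expr0.
by rewrite expr0n /= mulr0.
Unshelve. all: by end_near. Qed.

Lemma pseries_sum (c : 'I_N -> R) (f : 'I_N -> nat -> R) t :
  (forall l, cvgn (pseries (f l) t)) ->
  limn (pseries (fun k => \sum_l c l * f l k) t) =
  \sum_l c l * limn (pseries (f l) t).
Proof.
move=> cf; apply/cvg_lim => //.
have -> : pseries (fun k => \sum_l c l * f l k) t =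
    (fun n => \sum_l c l * pseries (f l) t n).
  apply/funext => n; rewrite /pseries /series /=.
  under eq_bigr do rewrite mulr_suml.
  rewrite exchange_big /=; apply: eq_bigr => l _; rewrite mulr_sumr.
  by apply: eq_bigr => k _; rewrite mulrA.
apply: cvg_big => [|l _]; first exact: add_continuous.
by apply: cvgM; [exact: cvg_cst|exact: cf].
Qed.

(** The matrix exponential solves E' = A E: its entries are power series, which
    are differentiated termwise. *)
Lemma is_derive_phi t i j :
  is_derive t (1 : R) (fun t => phi A t i j) ((A *m phi A t) i j).
Proof.
have -> : (fun t => phi A t i j) = fun t => limn (pseries (exp_entry 0 i j) t).
  by apply/funext => u; rewrite phi_entry.
have diffsE p : pseries_diffs (exp_entry p i j) = exp_entry p.+1 i j.
  apply/funext => k; rewrite /pseries_diffs /exp_entry addSnnS mulrA.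
  by rewrite factS natrM invfM mulrA mulfV ?mul1r // pnatr_eq0.
have -> : (A *m phi A t) i j = limn (pseries (pseries_diffs (exp_entry 0 i j)) t).
  rewrite diffsE mxE; under eq_bigr do rewrite phi_entry.
  rewrite -pseries_sum => [|l]; last exact: is_cvg_exp_entry.
  congr (limn (pseries _ t)); apply/funext => k.
  rewrite /exp_entry addn1 addn0 exprS mxE mulr_sumr.
  by apply: eq_bigr => l _; ring.
apply: (@pseries_snd_diffs _ _ (`|t| + 1)); rewrite ?diffsE;
  [exact: is_cvg_exp_entry..|].
by rewrite [ltRHS]ger0_norm ?ltrDl // addr_ge0.
Qed.

Lemma phi_comm t : A *m phi A t = phi A t *m A.
Proof.
apply/matrixP => i j; rewrite !mxE.
under eq_bigr do rewrite phi_entry.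
under [RHS]eq_bigr do rewrite phi_entry mulrC.
rewrite -!pseries_sum => [|l|l]; try exact: is_cvg_exp_entry.
congr (limn (pseries _ t)); apply/funext => k.
transitivity (k`!%:R^-1 * (A * A ^+ k) i j).
  by rewrite mxE mulr_sumr; apply: eq_bigr => l _; rewrite /exp_entry addn0; ring.
rewrite -exprS exprSr mxE mulr_sumr.
by apply: eq_bigr => l _; rewrite /exp_entry addn0; ring.
Qed.

(** The left-hand side has derivative E(a + t) A E(- t) - E(a + t) A E(- t) = 0
    in t. *)
Lemma phi_addN a t : phi A (a + t) *m phi A (- t) = phi A a.
Proof.
apply/matrixP => i j.
pose G t := (phi A (a + t) *m phi A (- t)) i j.
suff : G t = G 0 by rewrite /G addr0 oppr0 phi0 mulmx1.
apply: is_derive_0_is_cst => {}t.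
have -> : G = \sum_l (fun t => phi A (a + t) i l * phi A (- t) l j).
  by apply/funext => u; rewrite /G mxE fct_sumE.
have dl l : is_derive t (1 : R) (fun t => phi A (a + t) i l)
    ((phi A (a + t) *m A) i l).
  rewrite -phi_comm -[X in is_derive _ _ _ X]mulr1.
  apply: (@is_derive1_comp _ (fun t => phi A t i l) (fun t => a + t)).
    exact: is_derive_phi.
  by rewrite (_ : (fun t => a + t) = shift a);
    [exact: is_derive_shift|apply/funext => u; rewrite /= addrC].
have dr l : is_derive t (1 : R) (fun t => phi A (- t) l j)
    (- (A *m phi A (- t)) l j).
  rewrite -mulrN1.
  apply: (@is_derive1_comp _ (fun t => phi A t l j) (fun t => - t)).
  exact: is_derive_phi.
apply: is_derive_eq.
transitivity (((phi A (a + t) *m A) *m phi A (- t)) i j -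
              (phi A (a + t) *m (A *m phi A (- t))) i j); last first.
  by rewrite mulmxA subrr.
rewrite !mxE -sumrB; apply: eq_bigr => l _.
by rewrite scalerN addrC; congr (_ - _); rewrite /GRing.scale /= mulrC.
Qed.

Lemma phiN t : phi A t *m phi A (- t) = 1%:M.
Proof. by rewrite -{1}[t]add0r phi_addN phi0. Qed.

Lemma phiD a t : phi A (a + t) = phi A a *m phi A t.
Proof.
by rewrite -(phi_addN a t) -mulmxA -{4}[t]opprK phiN mulmx1.
Qed.

End MatrixExponential.

(** * Riemann sums of exact forms on tori *)

Section Calculus.
Variable R : realType.

Section Smooth.
Variable m : nat.
Implicit Types (f c : 'rV[R]_m -> R) (x u v : 'rV[R]_m).

Lemma smooth_differentiable f x : smooth f -> differentiable f x.
Proof. by move=> /(_ [::] x). Qed.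

Lemma smooth_derive f v : smooth f -> smooth (fun x => 'D_v f x).
Proof. by move=> sf vs x; have := sf (rcons vs v) x; rewrite foldr_rcons. Qed.

Lemma is_derive_line f x v s : differentiable f (x + s *: v) ->
  is_derive s (1 : R) (fun s => f (x + s *: v)) ('D_v f (x + s *: v)).
Proof.
move=> df; have dv := @diff_derivable _ _ _ f _ v df.
have E : (fun h : R => h^-1 *: (f (x + (h *: 1 + s) *: v) - f (x + s *: v))) =
    (fun h => h^-1 *: (f (h *: v + (x + s *: v)) - f (x + s *: v))).
  apply/funext => h; congr (_ *: (f _ - _)).
  by rewrite scalerDl [h *: 1]mulr1 addrCA.
by apply: DeriveDef; rewrite /derivable /derive /= E.
Qed.

Lemma smooth_bounded f r : smooth f ->
  exists2 C, 0 <= C & forall x, `|x| <= r -> `|f x| <= C.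
Proof.
move=> sf; pose K := [set x : 'rV[R]_m | `|x| <= r].
have cK : compact K.
  apply: bounded_closed_compact.
    by exists r; split => [|y ry x /= xr]; [exact: num_real|exact: le_trans (ltW ry)].
  have -> : K = (fun x => `|x|) @^-1` [set y | y <= r] by [].
  apply: closed_comp => [x _|]; first exact: norm_continuous.
  exact: closed_le.
have : compact (f @` K).
  apply: continuous_compact => //; apply: continuous_subspaceT => x.
  exact/differentiable_continuous/smooth_differentiable.
move=> /compact_bounded[M [_ MK]]; exists (`|M| + 1) => [|x xr].
  by rewrite addr_ge0.
apply: MK; last by exists x.
by rewrite (le_lt_trans (ler_norm M)) // ltrDl.
Qed.

End Smooth.

(** By the mean value theorem, applied twice, the sum differs by O(1) from m
    times the telescoping sum of the increments of h, which is
    m (h 1 - h 0) = 0. *)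
Lemma periodic_riemann_sum (h h' h'' : R -> R) C (m : nat) :
  (forall s, is_derive s (1 : R) h (h' s)) ->
  (forall s, is_derive s (1 : R) h' (h'' s)) ->
  (forall s, 0 <= s <= 1 -> `|h'' s| <= C) ->
  h 1 = h 0 -> (0 < m)%N -> `|\sum_(i < m) h' (i%:R / m%:R)| <= C.
Proof.
move=> dh dh' hC h10 m0.
have mR : 0 < m%:R :> R by rewrite ltr0n.
have cont (f f' : R -> R) a b : (forall s, is_derive s (1 : R) f (f' s)) ->
    {within `[a, b], continuous f}.
  move=> df; apply: continuous_subspaceT => s.
  by apply/differentiable_continuous/derivable1_diffP; case: (df s).
pose p i : R := i%:R / m%:R.
have pS i : p i.+1 - p i = m%:R^-1.
  by rewrite /p -mulrBl -natr1 addrAC subrr add0r mul1r.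
have term (i : 'I_m) : `|h' (p i) - m%:R * (h (p i.+1) - h (p i))| <= C / m%:R.
  have pp : p i <= p i.+1 by rewrite -subr_ge0 pS invr_ge0 ltW.
  have [xi] := MVT_segment pp (fun s _ => dh s) (cont _ _ _ _ dh).
  rewrite in_itv /= => /andP[xi1 xi2]; rewrite pS => ->.
  have [z] := MVT_segment xi1 (fun s _ => dh' s) (cont _ _ _ _ dh').
  rewrite in_itv /= => /andP[z1 z2] e.
  rewrite [h' xi * _]mulrC mulVKf ?gt_eqF // distrC e normrM ler_pM //.
    apply: hC; rewrite (le_trans _ z1) ?divr_ge0 //=.
    rewrite (le_trans z2) // (le_trans xi2) // ler_pdivrMr // mul1r ler_nat.
    exact: ltn_ord.
  by rewrite ger0_norm ?subr_ge0 // -(pS i) lerB.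
have -> : \sum_(i < m) h' (p i) =
    \sum_(i < m) (h' (p i) - m%:R * (h (p i.+1) - h (p i))).
  rewrite sumrB -mulr_sumr -(big_mkord xpredT (fun i => h (p i.+1) - h (p i))).
  rewrite telescope_sumr // /p mul0r divff ?gt_eqF // h10.
  by rewrite subrr mulr0 subr0.
apply: le_trans (ler_norm_sum _ _ _) _.
apply: le_trans (ler_sum _ (fun i _ => term i)) _.
by rewrite sumr_const card_ord -[leLHS]mulr_natr mulfVK // gt_eqF.
Qed.

Lemma periodic_derive_sum m (c : 'rV[R]_m -> R) u r :
  smooth c -> (forall x, c (x + u) = c x) ->
  exists2 C, 0 <= C & forall x (k : nat), `|x| <= r -> (0 < k)%N ->
    `|\sum_(i < k) 'D_u c (x + (i%:R / k%:R) *: u)| <= C.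
Proof.
move=> sc pc.
have [C C0 hC] := smooth_bounded (r + `|u|) (smooth_derive u (smooth_derive u sc)).
exists C => // x k xr k0.
apply: (@periodic_riemann_sum (fun s => c (x + s *: u))
  (fun s => 'D_u c (x + s *: u)) (fun s => 'D_u (fun y => 'D_u c y) (x + s *: u))).
- by move=> s; apply: is_derive_line; exact: smooth_differentiable.
- move=> s; apply: is_derive_line.
  exact/smooth_differentiable/smooth_derive.
- move=> s /andP[s0 s1]; apply: hC; rewrite (le_trans (ler_normD _ _)) //.
  by rewrite lerD // normrZ ger0_norm // ler_piMl.
- by rewrite scale1r scale0r addr0 pc.
- by [].
Qed.

Section Grid.
Variables (m : nat) (u1 u2 : 'rV[R]_m).

(** k^2 times a Riemann sum for the integral of g over the parallelogram spanned
    by u1 and u2 at x. *)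
Definition grid_sum (g : 'rV[R]_m -> R) (k : nat) (x : 'rV[R]_m) : R :=
  \sum_(i < k) \sum_(j < k) g (x + (i%:R / k%:R) *: u1 + (j%:R / k%:R) *: u2).

(** Stokes on a torus: a is periodic along u1 and b along u2, so the average of
    the coefficient of an exact form tends to 0, here at the rate 1 / k. *)
Lemma grid_sum_exact (a b : 'rV[R]_m -> R) r :
  smooth a -> smooth b ->
  (forall x, a (x + u1) = a x) -> (forall x, b (x + u2) = b x) ->
  exists2 C, 0 <= C & forall x (k : nat), `|x| <= r -> (0 < k)%N ->
    `|grid_sum (fun y => 'D_u1 a y - 'D_u2 b y) k x| <= C * k%:R.
Proof.
move=> sa sb pa pb.
have [Ca Ca0 ha] := periodic_derive_sum (r + `|u2|) sa pa.
have [Cb Cb0 hb] := periodic_derive_sum (r + `|u1|) sb pb.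
exists (Ca + Cb); first exact: addr_ge0.
move=> x k xr k0; have kR : 0 < k%:R :> R by rewrite ltr0n.
have near u (j : 'I_k) : `|x + (j%:R / k%:R) *: u| <= r + `|u|.
  rewrite (le_trans (ler_normD _ _)) // lerD // normrZ ger0_norm ?divr_ge0 //.
  by rewrite ler_piMl // ler_pdivrMr // mul1r ler_nat ltnW.
rewrite /grid_sum.
under eq_bigr do rewrite sumrB.
rewrite sumrB mulrDl (le_trans (ler_normB _ _)) // lerD //.
  rewrite exchange_big (le_trans (ler_norm_sum _ _ _)) //=.
  rewrite -[k in leRHS]card_ord mulr_natr -sumr_const; apply: ler_sum => j _.
  under eq_bigr do rewrite addrAC.
  exact: ha.
rewrite (le_trans (ler_norm_sum _ _ _)) //.
rewrite -[k in leRHS]card_ord mulr_natr -sumr_const; apply: ler_sum => i _.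
exact: hb.
Qed.

(** Homotopy invariance of periods: moving the torus along e changes the sum at
    a speed which is a grid sum of the exact coefficient above, hence O(k),
    whereas the sum itself is of order k^2. *)
Lemma grid_sum_transport (g a b : 'rV[R]_m -> R) e :
  smooth g -> smooth a -> smooth b ->
  (forall x, a (x + u1) = a x) -> (forall x, b (x + u2) = b x) ->
  (forall x, 'D_e g x = 'D_u1 a x - 'D_u2 b x) ->
  exists2 C, 0 <= C & forall k : nat, (0 < k)%N ->
    `|grid_sum g k e - grid_sum g k 0| <= C * k%:R.
Proof.
move=> sg sa sb pa pb ge.
have [C C0 hC] := grid_sum_exact `|e| sa sb pa pb.
exists C => // k k0.
have dS t : is_derive t (1 : R) (fun t => grid_sum g k (t *: e))
    (grid_sum (fun y => 'D_u1 a y - 'D_u2 b y) k (t *: e)).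
  have -> : (fun t => grid_sum g k (t *: e)) =
    \sum_(i < k) \sum_(j < k)
      (fun t => g ((i%:R / k%:R) *: u1 + (j%:R / k%:R) *: u2 + t *: e)).
    apply/funext => s; rewrite fct_sumE; apply: eq_bigr => i _.
    by rewrite fct_sumE; apply: eq_bigr => j _; rewrite -addrA addrC.
  apply: is_derive_sum => i; apply: is_derive_sum => j.
  rewrite -ge -addrA addrC; apply: is_derive_line.
  exact: smooth_differentiable.
have [|t] := MVT_segment ler01 (fun s _ => dS s).
  apply: continuous_subspaceT => s.
  by apply/differentiable_continuous/derivable1_diffP; case: (dS s).
rewrite in_itv /= scale1r scale0r subr0 mulr1 => /andP[t0 t1] ->.
by apply: hC => //; rewrite normrZ ger0_norm // ler_piMl.
Qed.

End Grid.
End Calculus.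

(** * Forms of low degree and translations of the group *)

Section LowDegreeForms.
Variable R : realType.

Lemma derive_affine a b (f : 'rV[R]_a -> 'rV[R]_b) (v : 'rV[R]_a) l x :
  (forall h, f (h *: v + x) = f x + h *: l) -> 'D_v f x = l.
Proof.
move=> fE; apply: lim_near_cst => //.
near=> h; have h0 : h != 0 by near: h; exact: nbhs_dnbhs_neq.
by rewrite /= fE addrAC subrr add0r scalerA mulVf // scale1r.
Unshelve. all: by end_near. Qed.

Lemma pullback_affine a b (f : 'rV[R]_a -> 'rV[R]_b) (L : 'rV[R]_a -> 'rV[R]_b)
    p (w : dform R p b) x V :
  (forall x v h, f (h *: v + x) = f x + h *: L v) ->
  pullback f w x V = w (f x) (\matrix_(i < p) L (row i V)).
Proof.
move=> fE; rewrite /pullback; congr (w _ _).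
by apply/row_matrixP => i; rewrite !rowK; apply: derive_affine.
Qed.

Lemma fdiff1E m (w : dform R 1 m) x (v1 v2 : 'rV[R]_m) :
  ev2 (fdiff w x) v1 v2 =
  'D_v1 (fun z => w z v2) x - 'D_v2 (fun z => w z v1) x.
Proof.
rewrite /ev2 /fdiff big_ord_recl big_ord1 /= expr0 expr1 mul1r mulN1r.
have l1 : lift ord0 ord0 = ord_max :> 'I_2 by exact/val_inj.
rewrite l1 row0_col_mx row1_col_mx.
have r0 : row' ord0 (col_mx v1 v2 : 'M[R]_(1 + 1, m)) = v2.
  apply/row_matrixP => i; rewrite ord1 !row_id -[RHS](row1_col_mx v1 v2) -l1.
  by apply/rowP => j; rewrite !mxE.
have r1 : row' ord_max (col_mx v1 v2 : 'M[R]_(1 + 1, m)) = v1.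
  apply/row_matrixP => i; rewrite ord1 !row_id -[RHS](row0_col_mx v1 v2).
  have -> : ord0 = lift ord_max ord0 :> 'I_2 by exact/val_inj.
  by apply/rowP => j; rewrite !mxE.
by rewrite r0 r1.
Qed.

(** The rows are indexed by natural numbers, on which lift computes as bump. *)
Lemma fdiff2E m (w : dform R 2 m) x (V : 'M[R]_(3, m)) :
  let v (k : nat) := row (inord k) V in
  fdiff w x V =
  'D_(v 0%N) (fun z => ev2 (w z) (v 1%N) (v 2%N)) x
  - 'D_(v 1%N) (fun z => ev2 (w z) (v 0%N) (v 2%N)) x
  + 'D_(v 2%N) (fun z => ev2 (w z) (v 0%N) (v 1%N)) x.
Proof.
move=> v.
have r (i : 'I_3) z : w z (row' i V) =
    ev2 (w z) (v (bump i 0)) (v (bump i 1)).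
  rewrite ev2E; congr ev2; apply/rowP => j; rewrite !mxE; congr (V _ j);
  by apply/val_inj; rewrite /= inordK //; case: i => -[|[|[]]].
rewrite /fdiff !big_ord_recl big_ord0 addr0 /=.
have vE (i : 'I_3) : row i V = v i by rewrite /v inord_val.
have D (i : 'I_3) : 'D_(row i V) (fun z => w z (row' i V)) x =
    'D_(v i) (fun z => ev2 (w z) (v (bump i 0)) (v (bump i 1))) x.
  by rewrite vE; congr ('D_(_) _ _); apply/funext => z; exact: r.
rewrite !D /= /bump /= expr0 expr1 sqrrN expr1n !mul1r mulN1r.
by rewrite addrA.
Qed.

End LowDegreeForms.

Section Group.
Variables (R : realType) (N : nat) (ad : 'M[R]_N).

Lemma ptGD (s t : R) (y z : 'rV[R]_N) : ptG s y + ptG t z = ptG (s + t) (y + z).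
Proof. by rewrite /ptG add_row_mx raddfD. Qed.

Lemma ptGZ (c t : R) (y : 'rV[R]_N) : c *: ptG t y = ptG (c * t) (c *: y).
Proof. by rewrite /ptG scale_row_mx scale_scalar_mx. Qed.

Lemma ptG_eta (g : 'rV[R]_(1 + N)) : ptG (tG g) (yG g) = g.
Proof.
rewrite -[RHS]hsubmxK /ptG /tG /yG; congr row_mx.
by apply/matrixP => i j; rewrite !ord1 mxE eqxx mulr1n.
Qed.

Lemma tGD (g h : 'rV[R]_(1 + N)) : tG (g + h) = tG g + tG h.
Proof. by rewrite /tG !mxE. Qed.
Lemma tGZ c (g : 'rV[R]_(1 + N)) : tG (c *: g) = c * tG g.
Proof. by rewrite /tG !mxE. Qed.
Lemma yGD (g h : 'rV[R]_(1 + N)) : yG (g + h) = yG g + yG h.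
Proof. by rewrite /yG raddfD. Qed.
Lemma yGZ c (g : 'rV[R]_(1 + N)) : yG (c *: g) = c *: yG g.
Proof. by rewrite /yG linearZ. Qed.

Lemma int_ptG s (z : 'rV[R]_N) : int_vec (ptG s z) <-> s \is a Num.int /\ int_vec z.
Proof.
split=> [h|[hs hz] j].
  split=> [|j].
    by have := h (lshift N 0); rewrite /ptG row_mxEl mxE eqxx mulr1n.
  by have := h (rshift 1 j); rewrite /ptG row_mxEr.
rewrite /ptG; case: (split_ordP j) => k ->; last by rewrite row_mxEr.
by rewrite row_mxEl ord1 mxE eqxx mulr1n.
Qed.

Lemma mulG_affine h x v c :
  mulG ad (c *: v + x) h =
  mulG ad x h + c *: ptG (tG v) (yG v *m phi ad (- tG h)).
Proof.
rewrite /mulG ptGZ ptGD !tGD !yGD tGZ yGZ mulmxDl -scalemxAl; congr ptG.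
  by rewrite -addrA addrC.
by rewrite -addrA addrC.
Qed.

(** Invariance under the right translation by h, evaluated: the translation is
    affine, so its differential is its linear part. *)
Lemma solv_forms_ev2 (W : dform R 2 (1 + N)) h x u v :
  solv_forms ad W -> int_vec h ->
  ev2 (W (mulG ad x h)) (ptG (tG u) (yG u *m phi ad (- tG h)))
    (ptG (tG v) (yG v *m phi ad (- tG h))) = ev2 (W x) u v.
Proof.
move=> [_ /(_ h)] /[apply] e.
rewrite -[in RHS]e [in RHS]/ev2 (pullback_affine _ _ _ (mulG_affine h)) ev2E.
by rewrite !rowK row0_col_mx row1_col_mx.
Qed.

End Group.

(** * Monodromy invariance of classes that extend *)

Section InvariantClass.
Variables (R : realType) (N : nat) (ad : 'M[R]_N).

Lemma solv_forms_periodic (W : dform R 2 (1 + N)) x u v (z : 'rV[R]_N) :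
  solv_forms ad W -> int_vec z ->
  ev2 (W (x + ptG 0 z)) u v = ev2 (W x) u v.
Proof.
move=> WS iz; have ih : int_vec (ptG 0 z) by apply/int_ptG; split.
rewrite -(solv_forms_ev2 x u v WS ih) tG_pt oppr0 phi0 !mulmx1 !ptG_eta.
by rewrite /mulG tG_pt yG_pt oppr0 phi0 mulmx1 -ptGD ptG_eta.
Qed.

Lemma smooth_ev2 m (W : dform R 2 m) u v :
  smooth_form W -> smooth (fun x => ev2 (W x) u v).
Proof. by move=> sW; exact: sf_smooth. Qed.

Lemma fdiff0_ev2 m (W : dform R 2 m) x e u v : fdiff W = (fun _ _ => 0) ->
  'D_e (fun z => ev2 (W z) u v) x =
  'D_u (fun z => ev2 (W z) e v) x - 'D_v (fun z => ev2 (W z) e u) x.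
Proof.
move=> dW; pose V := \matrix_(i < 3) nth 0 [:: e; u; v] i.
have := congr1 (fun f => f x V) dW; rewrite /= fdiff2E !rowK !inordK //=.
by move/eqP; rewrite -addrA addr_eq0 opprD opprK => /eqP.
Qed.

(** The constant form contributes exactly k^2 times its value on v1 and v2, and
    the exact part only O(k). *)
Lemma fibre_grid_sum (F : covec R 2 N) (b : dform R 1 N) v1 v2 :
  torus_forms b -> int_vec v1 -> int_vec v2 ->
  exists2 C, 0 <= C & forall k : nat, (0 < k)%N ->
    `|grid_sum v1 v2 (fun y => ev2 F v1 v2 + ev2 (fdiff b y) v1 v2) k 0
      - k%:R ^+ 2 * ev2 F v1 v2| <= C * k%:R.
Proof.
move=> [sb pb] i1 i2.
have per z v x : int_vec z -> b (x + z) v = b x v.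
  move=> iz; rewrite -[in RHS](pb _ iz) (@pullback_affine _ _ _ _ id).
    congr (b _ _); apply/row_matrixP => i; by rewrite rowK.
  by move=> y w h; rewrite -addrA addrC.
have [C C0 hC] := grid_sum_exact 0 (sf_smooth sb v2) (sf_smooth sb v1)
  (fun x => per v1 v2 x i1) (fun x => per v2 v1 x i2).
exists C => // k k0; have := hC 0 k; rewrite normr0 => /(_ (lexx _) k0).
congr (`|_| <= _); rewrite /grid_sum.
under [in RHS]eq_bigr do under eq_bigr do rewrite fdiff1E.
under [in RHS]eq_bigr do rewrite big_split sumr_const card_ord.
rewrite big_split /= sumr_const card_ord -mulrnA -[_ *+ (k * k)]mulr_natl.
by rewrite natrM -expr2 addrAC subrr add0r.
Qed.

(** The restrictions of W to the fibres over 0 and 1 are cohomologous, since W is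
    closed and the fibre moves continuously, and the monodromy maps the first
    to the second, since W is invariant under the translation by (1, 0). Both
    facts are read on grid sums over the tori spanned by lattice vectors: the
    values of F on (v1, v2) and on their images differ by O(1 / k) for every
    k. *)
Lemma closed_extension_invariant_int (W : dform R 2 (1 + N)) (F : covec R 2 N)
    (b : dform R 1 N) v1 v2 :
  solv_forms ad W -> fdiff W = (fun _ _ => 0) -> torus_forms b ->
  (forall y V, pullback (fun y => ptG 0 y) W y V - F V = fdiff b y V) ->
  int_vec v1 -> int_vec v2 ->
  int_vec (v1 *m phi ad (-1)) -> int_vec (v2 *m phi ad (-1)) ->
  ev2 F (v1 *m phi ad (-1)) (v2 *m phi ad (-1)) = ev2 F v1 v2.
Proof.
move=> WS dW tb WF i1 i2; set w1 := v1 *m _; set w2 := v2 *m _ => j1 j2.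
have sW := WS.1.
have fib y a c : ev2 (W (ptG 0 y)) (ptG 0 a) (ptG 0 c) =
    ev2 F a c + ev2 (fdiff b y) a c.
  have := WF y (col_mx a c : 'M[R]_(1 + 1, N)).
  rewrite (pullback_affine (L := fun y => ptG 0 y)); last first.
    by move=> x v h; rewrite ptGZ ptGD mulr0 addr0 addrC.
  by rewrite ev2E !rowK row0_col_mx row1_col_mx /ev2 => <-; rewrite addrC subrK.
pose S a c k e := grid_sum (ptG 0 a) (ptG 0 c)
  (fun x => ev2 (W x) (ptG 0 a) (ptG 0 c)) k e.
have S0 a c k : S a c k 0 =
    grid_sum a c (fun y => ev2 F a c + ev2 (fdiff b y) a c) k 0.
  apply: eq_bigr => i _; apply: eq_bigr => j _.
  by rewrite !add0r !ptGZ ptGD !mulr0 addr0 fib.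
have S1 k : S w1 w2 k (ptG 1 0) = S v1 v2 k 0.
  apply: eq_bigr => i _; apply: eq_bigr => j _.
  have ih : int_vec (ptG 1 0 : 'rV[R]_(1 + N)).
    by apply/int_ptG; split => // l; rewrite mxE.
  rewrite add0r -[RHS](solv_forms_ev2 _ _ _ WS ih) !(tG_pt, yG_pt).
  congr (ev2 (W _)); rewrite !ptGZ !ptGD /mulG !(tG_pt, yG_pt) !mulr0 !addr0.
  by rewrite !add0r mulmxDl -!scalemxAl.
have [C1 C10 h1] := fibre_grid_sum F tb j1 j2.
have [C2 C20 h2] := fibre_grid_sum F tb i1 i2.
have [C3 C30 h3] := grid_sum_transport (u1 := ptG 0 w1) (u2 := ptG 0 w2)
  (e := ptG 1 0) (smooth_ev2 (ptG 0 w1) (ptG 0 w2) sW)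
  (smooth_ev2 (ptG 1 0) (ptG 0 w2) sW) (smooth_ev2 (ptG 1 0) (ptG 0 w1) sW)
  (fun x => solv_forms_periodic x _ _ WS j1)
  (fun x => solv_forms_periodic x _ _ WS j2)
  (fun x => fdiff0_ev2 x _ _ _ dW).
apply/eqP; rewrite -subr_eq0; apply: contraT => d0.
set d := _ - _ in d0.
have dk (k : nat) : (0 < k)%N -> k%:R * `|d| <= C1 + C2 + C3.
  move=> k0; have kR : 0 < k%:R :> R by rewrite ltr0n.
  suff : k%:R * (k%:R * `|d|) <= k%:R * (C1 + C2 + C3) by rewrite ler_pM2l.
  have nk : k%:R ^+ 2 = `|k%:R ^+ 2| :> R by rewrite ger0_norm // exprn_ge0 // ltW.
  rewrite mulrA -expr2 nk -normrM mulrBr [leRHS]mulrC !mulrDl.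
  have := h1 k k0; have := h2 k k0; have := h3 k k0.
  rewrite -/(S w1 w2 k 0) -/(S w1 w2 k (ptG 1 0)) S1 -!S0.
  rewrite !ler_norml => /andP[a1 a2] /andP[b1 b2] /andP[c1 c2].
  by apply/andP; split; lra.
have [k hk] : exists k : nat, C1 + C2 + C3 < k.+1%:R * `|d|.
  exists (Num.bound ((C1 + C2 + C3) / `|d|)).
  have q0 : 0 <= (C1 + C2 + C3) / `|d| by rewrite divr_ge0 // !addr_ge0.
  rewrite -ltr_pdivrMr ?normr_gt0 //; apply: lt_le_trans (archi_boundP q0) _.
  by rewrite ler_nat.
by have := dk k.+1 isT; rewrite leNgt hk.
Qed.

(** The lattice is preserved by phi(-1), because it is a subgroup: the product
    (0, y) (1, 0) is (1, phi(-1) y). Bilinearity extends the equality from the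
    standard basis to all vectors. *)
Lemma closed_extension_invariant (W : dform R 2 (1 + N)) (F : covec R 2 N)
    (b : dform R 1 N) :
  lattice ad (@int_vec R (1 + N)) -> alternating_covec F ->
  solv_forms ad W -> fdiff W = (fun _ _ => 0) -> torus_forms b ->
  (forall y V, pullback (fun y => ptG 0 y) W y V - F V = fdiff b y V) ->
  forall x y, ev2 F (x *m phi ad (-1)) (y *m phi ad (-1)) = ev2 F x y.
Proof.
move=> L aF WS dW tb WF x y; set P := phi ad (-1).
have idelta i : int_vec (delta_mx 0 i : 'rV[R]_N).
  by move=> j; rewrite mxE; case: (_ && _).
have iP i : int_vec (delta_mx 0 i *m P).
  have i1 : int_vec (ptG 0 (delta_mx 0 i) : 'rV[R]_(1 + N)) by apply/int_ptG; split.
  have i2 : int_vec (ptG 1 0 : 'rV[R]_(1 + N)).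
    by apply/int_ptG; split => // l; rewrite mxE.
  have := lat_mul L i1 i2; rewrite /mulG !(tG_pt, yG_pt) addr0.
  by move=> /int_ptG[].
suff PG : P *m gram F *m P^T = gram F.
  by rewrite !ev2_gram // trmx_mul !mulmxA -[x *m P *m _]mulmxA
    -[x *m (P *m _) *m _]mulmxA PG.
apply/matrixP => i j; rewrite [RHS]mxE.
rewrite -(closed_extension_invariant_int WS dW tb WF (idelta i) (idelta j)
  (iP i) (iP j)).
rewrite ev2_gram // -!rowE tr_row !mxE.
apply: eq_bigr => l _; rewrite !mxE; congr (_ * _).
by apply: eq_bigr => k _; rewrite !mxE.
Qed.

End InvariantClass.

(** * The symplectic form *)

Section SymplecticForm.
Variables (R : realType) (N : nat) (ad : 'M[R]_N).

(** t (t - 1) ... (t - j + 1). *)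
Fixpoint falling_poly (j : nat) : {poly R} :=
  if j is j'.+1 then falling_poly j' * ('X - j'%:R%:P) else 1.

(** binom(t, j), the coefficient of z^j in (1 + z)^t. *)
Definition binom_poly j : {poly R} := j`!%:R^-1 *: falling_poly j.
Arguments binom_poly : simpl never.

Lemma falling_polyS j t :
  (falling_poly j.+1).[t + 1] = (t + 1) * (falling_poly j).[t].
Proof.
have S i : falling_poly i.+1 = falling_poly i * ('X - i%:R%:P) by [].
elim: j t => [|j IH] t; first by rewrite S !hornerE subr0.
by rewrite S hornerM hornerXsubC IH S hornerM hornerXsubC -natr1; ring.
Qed.

Lemma binom_polyS j t :
  (binom_poly j.+1).[t + 1] = (binom_poly j.+1).[t] + (binom_poly j).[t].
Proof.
have S : falling_poly j.+1 = falling_poly j * ('X - j%:R%:P) by [].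
have j1 : j%:R + 1 != 0 :> R by rewrite natr1 pnatr_eq0.
have j2 : j`!%:R != 0 :> R by rewrite pnatr_eq0 -lt0n fact_gt0.
rewrite /binom_poly !hornerZ falling_polyS S hornerM hornerXsubC factS natrM.
by rewrite -natr1; field; rewrite ?j1 ?j2.
Qed.

Lemma differentiable_horner_tG (p : {poly R}) (x : 'rV[R]_(1 + N)) :
  differentiable (fun z => p.[tG z]) x.
Proof.
apply: (@differentiable_comp _ _ _ _ (fun z => tG z) (horner p)).
  rewrite (_ : (fun z => tG z) = fun z : 'rV[R]_(1 + N) => z 0 (lshift N 0)).
    exact: differentiable_coord.
  by apply/funext => z; rewrite /tG mxE.
exact/derivable1_diffP/derivable_horner.
Qed.

Lemma derive_horner_tG (p : {poly R}) (x v : 'rV[R]_(1 + N)) :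
  'D_v (fun z => p.[tG z]) x = (tG v *: p^`()).[tG x].
Proof.
have := @is_derive_line _ _ (fun z => p.[tG z]) x v 0 (differentiable_horner_tG p _).
rewrite scale0r addr0 => -[_ <-].
pose q : {poly R} := (tG x)%:P + tG v *: 'X.
have qE s : q.[s] = tG x + s * tG v by rewrite /q !hornerE mulrC.
have -> : (fun s => p.[tG (x + s *: v)]) = horner (p \Po q).
  by apply/funext => s; rewrite horner_comp qE tGD tGZ.
rewrite -derive1E -derivE deriv_comp hornerM horner_comp qE mul0r addr0.
by rewrite /q derivD derivC derivZ derivX add0r !hornerZ hornerC mulr1 mulrC.
Qed.

Lemma smooth_horner_tG (p : {poly R}) :
  smooth (fun z : 'rV[R]_(1 + N) => p.[tG z]).
Proof.
move=> vs x.
have [q ->] : exists q : {poly R}, foldr (fun v g => fun z => 'D_v g z)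
    (fun z : 'rV[R]_(1 + N) => p.[tG z]) vs = fun z => q.[tG z].
  elim: vs => [|v vs [q IH]] /=; first by exists p.
  by exists (tG v *: q^`()); rewrite IH; apply/funext => z; exact: derive_horner_tG.
exact: differentiable_horner_tG.
Qed.

Variables (F : covec R 2 N) (eta : covec R 1 N) (K : nat).
Hypothesis altF : alternating_covec F.
Hypothesis altE : alternating_covec eta.
Hypothesis eta_nil :
  iter K.+1 (fun b => fun V => phi_star ad b V - b V) eta = (fun=> 0).
Hypothesis F_inv :
  forall x y, ev2 F (x *m phi ad (-1)) (y *m phi ad (-1)) = ev2 F x y.

Definition eta_iter j : covec R 1 N :=
  iter j (fun b => fun V => phi_star ad b V - b V) eta.

Arguments eta_iter : simpl never.

Lemma eta_iterS j v : eta_iter j.+1 v = eta_iter j (v *m phi ad 1) - eta_iter j v.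
Proof. by []. Qed.

Lemma eta_iter_lin j c d x y :
  eta_iter j (c *: x + d *: y) = c * eta_iter j x + d * eta_iter j y.
Proof.
elim: j c d x y => [|j IH] c d x y.
  apply: (alternating_multilinear altE (i := ord0)); rewrite ?row_id //;
  by move=> k; rewrite ord1.
by rewrite !eta_iterS mulmxDl -!scalemxAl !IH; ring.
Qed.

(** The path (phi^* )^t eta, expanded by the binomial series in the nilpotent
    operator phi^* - 1; it is polynomial in t. Unlike phi(t)^* eta, it
    keeps the value of eta on the kernel of F, which phi(t) need not fix for
    non-integer t. *)
Definition eta_path (v : 'rV[R]_N) : {poly R} :=
  \sum_(j < K.+1) eta_iter j v *: binom_poly j.

Lemma eta_path_lin c d x y :
  eta_path (c *: x + d *: y) = c *: eta_path x + d *: eta_path y.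
Proof.
rewrite /eta_path !scaler_sumr -big_split; apply: eq_bigr => j _ /=.
by rewrite eta_iter_lin scalerDl -!scalerA.
Qed.

Lemma eta_pathS v t : (eta_path v).[t + 1] = (eta_path (v *m phi ad 1)).[t].
Proof.
have binomZ c j u : (c *: binom_poly j).[u] = c * (binom_poly j).[u].
  exact: hornerZ.
rewrite /eta_path !horner_sum.
transitivity (\sum_(j < K.+1) (eta_iter j v * (binom_poly j).[t]
    + eta_iter j.+1 v * (binom_poly j).[t])); last first.
  by apply: eq_bigr => j _; rewrite binomZ -mulrDl eta_iterS addrC subrK.
have etaK0 : eta_iter K.+1 v = 0 by rewrite /eta_iter eta_nil.
rewrite big_split /= [X in _ = _ + X]big_ord_recr /= etaK0 mul0r addr0.
rewrite !big_ord_recl /= -addrA -big_split; congr (_ + _).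
  by rewrite binomZ /binom_poly /= !hornerE.
apply: eq_bigr => j _ /=.
by rewrite binomZ binom_polyS mulrDr.
Qed.

Lemma int_num_ind (Q : R -> Prop) :
  Q 0 -> (forall s, Q s -> Q (s + 1)) -> (forall s, Q s -> Q (s - 1)) ->
  forall s, s \is a Num.int -> Q s.
Proof.
move=> Q0 Qp Qm s /intrP[z ->].
elim/int_rec: z => [//|k|k].
  by rewrite -!pmulrn -natr1; exact: Qp.
by rewrite !rmorphN /= -!pmulrn -natr1 opprD; exact: Qm.
Qed.

Lemma phi_opp_add1 (v : 'rV[R]_N) s :
  v *m phi ad (- (s + 1)) = v *m phi ad (- s) *m phi ad (-1).
Proof. by rewrite opprD phiD mulmxA. Qed.

Lemma phi_opp_sub1 (v : 'rV[R]_N) s :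
  v *m phi ad (- (s - 1)) = v *m phi ad (- s) *m phi ad 1.
Proof. by rewrite opprB addrC phiD mulmxA. Qed.

Lemma phiK (v : 'rV[R]_N) : v *m phi ad 1 *m phi ad (-1) = v.
Proof. by rewrite -mulmxA phiN mulmx1. Qed.

Lemma phiNK (v : 'rV[R]_N) : v *m phi ad (-1) *m phi ad 1 = v.
Proof. by rewrite -mulmxA -{2}[1]opprK phiN mulmx1. Qed.

Lemma F_inv_int s x y : s \is a Num.int ->
  ev2 F (x *m phi ad (- s)) (y *m phi ad (- s)) = ev2 F x y.
Proof.
move=> si; move: s si x y; apply: int_num_ind => [x y|s IH x y|s IH x y].
- by rewrite oppr0 phi0 !mulmx1.
- by rewrite (phi_opp_add1 x s) (phi_opp_add1 y s) F_inv.
- by rewrite (phi_opp_sub1 x s) (phi_opp_sub1 y s) -F_inv !phiK.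
Qed.

Lemma eta_path_int s v t : s \is a Num.int ->
  (eta_path (v *m phi ad (- s))).[t + s] = (eta_path v).[t].
Proof.
move=> si; move: s si v t; apply: int_num_ind => [v t|s IH v t|s IH v t].
- by rewrite oppr0 phi0 mulmx1 addr0.
- by rewrite (phi_opp_add1 v s) addrA eta_pathS phiNK.
- by rewrite (phi_opp_sub1 v s) -eta_pathS addrA subrK.
Qed.

(** F + eta_t /\ dt evaluated on u and v, as a polynomial in the coordinate t of
    the base point. *)
Definition omega_poly (u v : 'rV[R]_(1 + N)) : {poly R} :=
  (ev2 F (yG u) (yG v))%:P + tG v *: eta_path (yG u) - tG u *: eta_path (yG v).

Definition omega : dform R 2 (1 + N) := fun x V =>
  (omega_poly (row ord0 V) (row ord_max V)).[tG x].

Lemma ev2_omega x u v : ev2 (omega x) u v = (omega_poly u v).[tG x].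
Proof. by rewrite /ev2 /omega row0_col_mx row1_col_mx. Qed.

Lemma omega_alternating x : alternating_covec (omega x).
Proof.
have skew u v : omega_poly u v = - omega_poly v u.
  by rewrite /omega_poly ev2C // polyCN !opprD opprK addrAC.
have linl c d u v w :
    omega_poly (c *: u + d *: v) w = c *: omega_poly u w + d *: omega_poly v w.
  rewrite /omega_poly !(yGD, yGZ, tGD, tGZ) ev2_linl // eta_path_lin.
  by rewrite -!mul_polyC !polyCD !polyCM; ring.
split=> [i c d V V1 V2 eV /row'_eqP e1 /row'_eqP e2|i j V ij e].
  rewrite /omega; case: (ord2_cases i) eV e1 e2 => -> eV e1 e2.
    by rewrite (e1 ord_max) // (e2 ord_max) // eV linl hornerD !hornerZ.
  rewrite (e1 ord0) // (e2 ord0) // eV skew linl [omega_poly _ (row ord_max V1)]skew.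
  by rewrite [omega_poly _ (row ord_max V2)]skew hornerN hornerD !hornerZ !hornerN; ring.
have e01 : row ord0 V = row ord_max V.
  by case: (ord2_cases i) (ord2_cases j) ij e => -> [] ->.
by rewrite /omega e01 /omega_poly ev2xx // add0r subrr horner0.
Qed.

Lemma omega_solv : solv_forms ad omega.
Proof.
split; first by split; [exact: omega_alternating|move=> V; exact: smooth_horner_tG].
move=> h /[dup] ih; rewrite -{1}(ptG_eta h) => /int_ptG[it _].
apply/funext => x; apply/funext => V.
rewrite (pullback_affine _ _ _ (mulG_affine ad h)) /omega !rowK /omega_poly.
rewrite /mulG !(tG_pt, yG_pt) F_inv_int //.
by rewrite !(hornerD, hornerN, hornerZ, hornerC) !eta_path_int.
Qed.

(** The coefficients depend on t only, so d(F + eta_t /\ dt) = dt /\ eta'_t /\ dt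
    = 0. *)
Lemma omega_closed : fdiff omega = (fun _ _ => 0).
Proof.
apply/funext => x; apply/funext => V; rewrite fdiff2E.
have D w u v : 'D_w (fun z => ev2 (omega z) u v) x =
    tG w * (tG v * (eta_path (yG u))^`().[tG x]
            - tG u * (eta_path (yG v))^`().[tG x]).
  have -> : (fun z => ev2 (omega z) u v) = fun z => (omega_poly u v).[tG z].
    by apply/funext => z; rewrite ev2_omega.
  rewrite derive_horner_tG /omega_poly hornerZ derivB derivD derivC add0r !derivZ.
  by rewrite hornerD hornerN !hornerZ.
by rewrite !D; ring.
Qed.

Hypothesis eta_neq0 :
  forall k, k != 0 -> (forall y, ev2 F k y = 0) -> eta k != 0.

(** The kernel of F is a line stable under phi, hence spanned by an eigenvector;
    as phi^* is unipotent on eta, which does not vanish there, the eigenvalue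
    is 1. *)
Lemma kernel_fixed k : (forall y, ev2 F k y = 0) -> k *m phi ad 1 = k.
Proof.
move=> Fk; have [->|k0] := eqVneq k 0; first by rewrite mul0mx.
have ek := eta_neq0 k0 Fk.
have eta_lin c d x y : eta (c *: x + d *: y) = c * eta x + d * eta y.
  exact: (eta_iter_lin 0).
have Fk1 y : ev2 F (k *m phi ad 1) y = 0.
  by rewrite -F_inv phiK Fk.
pose l := eta (k *m phi ad 1) / eta k.
have kl : k *m phi ad 1 = l *: k.
  apply/eqP; rewrite -subr_eq0 -scaleN1r -[X in X + _]scale1r scalerA.
  apply: contraT => /eta_neq0.
  rewrite eta_lin mul1r mulN1r mulNr /l divfK // subrr eqxx => H.
  by apply: H => y; rewrite ev2_linl // Fk Fk1 !mulr0 addr0.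
have it j : eta_iter j k = (l - 1) ^+ j * eta k.
  elim: j => [|j IH]; first by rewrite expr0 mul1r.
  by rewrite eta_iterS kl -[l *: k]addr0 -(scale0r k) eta_iter_lin IH exprS; ring.
have := it K.+1; rewrite {1}/eta_iter eta_nil => /esym/eqP.
rewrite mulf_eq0 expf_eq0 (negPf ek) orbF subr_eq0 => /eqP l1.
by rewrite kl l1 scale1r.
Qed.

(** All the terms of the binomial series but the first vanish on the kernel of
    F, which phi fixes. *)
Lemma eta_path_kernel k t : (forall y, ev2 F k y = 0) -> (eta_path k).[t] = eta k.
Proof.
move=> Fk; rewrite /eta_path big_ord_recl big1 ?addr0 => [|j _].
  by rewrite /binom_poly fact0 invr1 scale1r /= !hornerE.
by rewrite eta_iterS kernel_fixed // subrr scale0r.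
Qed.

(** The dimension N of the fibre is odd, so the kernel of F contains some nonzero
    k, on which every eta_t takes the value eta k, which is not 0. Pairing a
    null vector u of omega with k shows that u is tangent to the fibre;
    pairing it with the fibre and with d/dt, that u lies in the kernels of F
    and of eta. *)
Lemma omega_nondegenerate x u : odd N ->
  (forall v, ev2 (omega x) u v = 0) -> u = 0.
Proof.
move=> oN uv.
have [k k0 Fk] := odd_kernel altF oN.
have eta_lin0 : eta_path 0 = 0.
  by have := eta_path_lin 0 0 0 0; rewrite !scale0r addr0 => ->; rewrite addr0.
have ev20 a : ev2 F a 0 = 0 by exact: ev20r.
have tu : tG u = 0.
  have := uv (ptG 0 k); rewrite ev2_omega /omega_poly tG_pt yG_pt ev2C // Fk.
  rewrite oppr0 scale0r !add0r hornerN hornerZ eta_path_kernel // => /eqP.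
  by rewrite oppr_eq0 mulf_eq0 (negPf (eta_neq0 k0 Fk)) orbF => /eqP.
have Fu y : ev2 F (yG u) y = 0.
  have := uv (ptG 0 y); rewrite ev2_omega /omega_poly tG_pt yG_pt tu.
  by rewrite !scale0r subr0 addr0 hornerC.
have eu : eta (yG u) = 0.
  have := uv (ptG 1 0); rewrite ev2_omega /omega_poly tG_pt yG_pt tu ev20.
  by rewrite scale0r subr0 add0r scale1r eta_path_kernel.
have yu : yG u = 0.
  by apply/eqP; apply: contraT => /eta_neq0/(_ Fu); rewrite eu eqxx.
by rewrite -(ptG_eta u) tu yu /ptG raddf0 row_mx0.
Qed.

End SymplecticForm.

(** * Extending classes of the fibre through the models *)

Section Model.
Variables (R : realType) (N : nat) (ad : 'M[R]_N) (X : mostow_model ad).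

(** Both the identity and mm_q o mm_inc extend the identity of the generators of
    the free algebra MU. *)
Lemma mm_incK (a : MU X) : mm_q X (mm_inc X a) = a.
Proof.
have [_ fU] := mc_free (MU_minimal X).
have [g [_ gu]] := fU (MU X) (@MU_gen _ _ _ X) (mc_free (MU_minimal X)).1.
have e1 : g = id by apply: gu; split => //; split.
suff e2 : g = mm_q X \o mm_inc X by have := congr1 (@^~ a) e2; rewrite e1.
apply: gu; split=> [|i] /=; last by rewrite mm_inc_gen mm_q_gen.
have [l1 o1 m1 g1] := mm_inc_morph X; have [[l2 o2 m2 g2] _] := mm_q_morph X.
by split=> *; rewrite /= ?l1 ?o1 ?m1 ?l2 ?o2 ?m2 //; apply/g2/g1.
Qed.

(** A class of U of degree 2 is represented by a cocycle of MU, which D_2 = d_2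
    turns into a cocycle of MS, that is into a closed form on S. *)
Lemma Unil2_extends (F : covec R 2 N) : D2_eq_d2 X -> Unil ad F ->
  exists (W : dform R 2 (1 + N)) (b : dform R 1 N),
    [/\ solv_forms ad W, fdiff W = (fun _ _ => 0), torus_forms b &
        forall y V, pullback (fun y => ptG 0 y) W y V - F V = fdiff b y V].
Proof.
move=> hD UF; have [_ _ /(_ (fun=> F))[]] := mm_rho_U X 2; first by exists F.
move=> a [ga da [b tb eb]].
have [il io im ig] := mm_inc_morph X; have [[tg tl _ _ td] _] := mm_tau_qi X.
have ig2 := ig _ _ ga.
exists (mm_tau X 2 (mm_inc X a)), b; split => //; first exact: tg.
  rewrite -td // hD // da.
  have -> : mm_inc X 0 = 0.
    by have := il (-1) 0 0; rewrite scaler0 addr0 scaleN1r addNr.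
  have := tl 3%N (-1) 0 0 (gr0 _ _) (gr0 _ _); rewrite scaler0 addr0 => ->.
  by apply/funext => x; apply/funext => V; rewrite mulN1r addNr.
move=> y V; rewrite mm_fibre // mm_incK.
by have := congr1 (fun f => f y V) eb.
Qed.

End Model.

Local Close Scope ring_scope.
Local Close Scope classical_set_scope.

Theorem proposition4 (R : realType) (n : nat) (hn : (1 <= n)%N)
    (ad : 'M[R]_(n.*2.-1))
    (hGamma : lattice ad (@int_vec R (1 + n.*2.-1)))
    (X : mostow_model ad) (hD : D2_eq_d2 X)
    (hU : exists (F : covec R 2 n.*2.-1) (eta : covec R 1 n.*2.-1),
      cosymplectic ad n F eta) :
  exists w : dform R 2 (1 + n.*2.-1), symplectic ad n w.
Proof.
have [F [eta [UF [altE [[//|K] _ nilE]] [V0 nz]]]] := hU.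
have [altF _] := UF.
have [W [b [WS dW tb WF]]] := Unil2_extends hD UF.
have F_inv := closed_extension_invariant hGamma altF WS dW tb WF.
have oN : odd n.*2.-1 by clear -hn; case: n hn => // m _; rewrite doubleS /= odd_double.
have eN : n.*2.-1 = (n.-1 * 2 + 1)%N.
  by clear -hn; case: n hn => // m _; rewrite doubleS muln2 addn1.
have eta_neq0 k :
  (k != 0 -> (forall y, ev2 F k y = 0) -> eta k != 0)%R.
  exact: cpow_wedge_neq0_kernel eN altF altE nz.
exists (omega ad F eta K); split; [exact: omega_solv|exact: omega_closed|].
move=> x; have altw := omega_alternating ad K altF altE x.
have [|V sV] := symplectic_rows_exist altw
  (fun u => omega_nondegenerate altF altE nilE F_inv eta_neq0 oN)
  (k := n) (m := (1 + n.*2.-1)%N).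
  by rewrite muln2 add1n prednK // double_gt0.
by exists V; rewrite gt_eqF // cpow_symplectic_rows.
Qed.
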